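(* For every partition $\lambda$ the following hold. Type 1: for $k\ge1$, $G^{(\alpha,\beta)}_{(k)}G^{(\alpha,\beta)}_\lambda=\sum_{\mu\supseteq\lambda,\ \mu/\lambda\text{ horizontal strip}}(\alpha+\beta)^{|\mu/\lambda|-k}\binom{r(\mu/\lambda)-1}{|\mu/\lambda|-k}G^{(\alpha,\beta)}_\mu$ and $G^{(\alpha,\beta)}_{(1^k)}G^{(\alpha,\beta)}_\lambda=\sum_{\mu\supseteq\lambda,\ \mu/\lambda\text{ vertical strip}}(\alpha+\beta)^{|\mu/\lambda|-k}\binom{c(\mu/\lambda)-1}{|\mu/\lambda|-k}G^{(\alpha,\beta)}_\mu$. Type 2: for $k\ge0$, $h_k\big(\frac{x}{1+\alpha x}\big)G^{(-\alpha,-\beta)}_\lambda=\sum_{\nu\supseteq\lambda,\ c(\nu/\lambda)=k}(\alpha+\beta)^{|\nu/\lambda|-k}G^{(-\alpha,-\beta)}_\nu$ and $e_k\big(\frac{x}{1+\alpha x}\big)G^{(-\alpha,-\beta)}_\lambda=\sum_{\nu\supseteq\lambda,\ \nu/\lambda\text{ vertical strip}}(\alpha+\beta)^{|\nu/\lambda|-k}\binom{|\nu/\lambda|-c(\nu/\lambda)}{k-c(\nu/\lambda)}G^{(-\alpha,-\beta)}_\nu$. Type 3: for $k\ge0$, $h_kG^{(-\alpha,-\beta)}_\lambda=\sum_\mu v^k_{\mu/\lambda}(\alpha,\beta)G^{(-\alpha,-\beta)}_\mu$ and $e_kG^{(-\alpha,-\beta)}_\lambda=\sum_\mu\bar v^k_{\mu/\lambda}(\alpha,\beta)G^{(-\alpha,-\beta)}_\mu$,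 where $v^k_{\mu/\lambda}(\alpha,\beta)=\beta^{r(\mu/\lambda)-b(\mu/\lambda)}(\alpha+\beta)^{i(\mu/\lambda)}\alpha^{c(\mu/\lambda)-k}\binom{c(\mu/\lambda)-b(\mu/\lambda)}{c(\mu/\lambda)-k}$ and $\bar v^k_{\mu/\lambda}(\alpha,\beta)=\alpha^{c(\mu/\lambda)-b(\mu/\lambda)}(\alpha+\beta)^{i(\mu/\lambda)}\beta^{r(\mu/\lambda)-k}\binom{r(\mu/\lambda)-b(\mu/\lambda)}{r(\mu/\lambda)-k}$ if $\lambda\subseteq\mu$, and both are $0$ otherwise.
   Context: Let $\alpha,\beta$ be indeterminates. For a partition $\lambda$ and $n\ge1$, $G^{(\alpha,\beta)}_\lambda(x_1,\ldots,x_n)=\det\Big[\frac{x_i^{\lambda_j+n-j}(1+\beta x_i)^{j-1}}{(1-\alpha x_i)^{\lambda_j}}\Big]_{1\le i,j\le n}\Big/\prod_{i<j}(x_i-x_j)$ (with $\lambda_j=0$ for $j>\ell(\lambda)$), stable under $x_{n+1}=0$, defining a symmetric power series $G^{(\alpha,\beta)}_\lambda$ in $x_1,x_2,\ldots$. $h_k,e_k$ are the complete homogeneous and elementary symmetric functions, and $h_k(\frac{x}{1+\alpha x})$ means $h_k(\frac{x_1}{1+\alpha x_1},\frac{x_2}{1+\alpha x_2},\ldots)$. For a skew shape $\mu/\lambda$: $|\mu/\lambda|$ is its number of boxes, $r(\mu/\lambda)$ its number of nonempty rows, $c(\mu/\lambda)$ its number of nonempty columns, $b(\mu/\lambda)$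 its number of (edge-)connected components, and $i(\mu/\lambda)=|\mu/\lambda|-c(\mu/\lambda)-r(\mu/\lambda)+b(\mu/\lambda)$. A horizontal (vertical) strip is a skew shape with at most one box in each column (row). Binomial coefficients $\binom nm$ are $0$ when $m<0$ or when $n\ge0$ and $m>n$, and any term containing a vanishing binomial coefficient is $0$. *)

(* Defs.v *)
From HB Require Import structures.
From mathcomp Require Import all_boot all_order all_algebra.
From mathcomp Require Import finmap multiset mpoly.
From mathcomp Require Import boolp classical_sets.

Set Implicit Arguments.
Unset Strict Implicit.
Unset Printing Implicit Defensive.

Import GRing.Theory.

Local Open Scope ring_scope.

(* A monomial in x_0, x_1, x_2, ... is the finite multiset of the indices of
   its variables: the product of monomials is `+`, the degree is the size. *)
Notation monom := {mset nat}%mset.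

Definition divisors_of (m : monom) : {fset monom} :=
  [fset seq_mset (mask (val b) m) | b in {: (size m).-tuple bool}]%fset.

Lemma in_divisors_of (k m : monom) : (k \in divisors_of m) = (k `<=` m)%mset.
Proof.
apply/imfsetP/msubsetP => [[b _ ->] x|km].
  by rewrite mset_seqE -[leqRHS]count_mem_mset leq_count_subseq ?mask_subseq.
have /count_subseqP[s /subseqP[b szb ->] kP] :
    forall x, (count_mem x k <= count_mem x m)%N.
  by move=> x; rewrite !count_mem_mset.
have szb' : size b == size m by rewrite szb.
by exists (Tuple szb') => //=; rewrite -[LHS]seq_mset_id; apply/eq_seq_msetP.
Qed.

(* R[[x_0, x_1, x_2, ...]]: one arbitrary coefficient for each monomial *)
Record fps (R : Type) := Fps { coef : monom -> R }.

Lemma fpsP (R : Type) (f g : fps R) : coef f =1 coef g -> f = g.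
Proof. by case: f g => [f] [g] /funext/= ->. Qed.

HB.instance Definition _ (R : Type) := gen_eqMixin (fps R).
HB.instance Definition _ (R : Type) := gen_choiceMixin (fps R).

HB.lock Definition fpsM (R : comNzRingType) (f g : fps R) : fps R :=
  Fps (fun m => \sum_(k <- divisors_of m) coef f k * coef g (m `\` k)%mset).

HB.lock Definition fvar (R : comNzRingType) (i : nat) : fps R :=
  Fps (fun m => (m == [mset i]%mset)%:R).
Arguments fvar {R} i.

Lemma coef_fpsM (R : comNzRingType) (f g : fps R) m :
  coef (fpsM f g) m =
  \sum_(k <- divisors_of m) coef f k * coef g (m `\` k)%mset.
Proof. by rewrite unlock. Qed.

Lemma coef_fvar (R : comNzRingType) i m :
  coef (fvar i : fps R) m = (m == [mset i]%mset)%:R.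
Proof. by rewrite unlock. Qed.

Section FpsRing.
Variable R : comNzRingType.
Implicit Types (f g h : fps R) (m k l : monom) (a b : R).

Definition fps0 : fps R := Fps (fun=> 0).
Definition fpsN f : fps R := Fps (fun m => - coef f m).
Definition fpsD f g : fps R := Fps (fun m => coef f m + coef g m).
Definition fps1 : fps R := Fps (fun m => (m == mset0)%:R).
Definition fpsZ a f : fps R := Fps (fun m => a * coef f m).

Fact fpsDA : associative fpsD.
Proof. by move=> f g h; apply: fpsP => m; rewrite /= addrA. Qed.
Fact fpsDC : commutative fpsD.
Proof. by move=> f g; apply: fpsP => m; rewrite /= addrC. Qed.
Fact fps0D : left_id fps0 fpsD.
Proof. by move=> f; apply: fpsP => m; rewrite /= add0r. Qed.
Fact fpsND : left_inverse fps0 fpsN fpsD.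
Proof. by move=> f; apply: fpsP => m; rewrite /= addNr. Qed.

HB.instance Definition _ :=
  GRing.isZmodule.Build (fps R) fpsDA fpsDC fps0D fpsND.

Lemma big_divisors_of_rev m (F : monom -> R) :
  \sum_(k <- divisors_of m) F k = \sum_(k <- divisors_of m) F (m `\` k)%mset.
Proof.
rewrite -[RHS](big_map (fun k => m `\` k)%mset xpredT F).
apply/perm_big/uniq_perm; rewrite ?fset_uniq //.
  rewrite map_inj_in_uniq ?fset_uniq // => k l.
  rewrite !in_divisors_of => km lm e.
  by rewrite -(msetBBK km) e msetBBK.
move=> k; apply/idP/mapP => [|[l + ->]]; last first.
  by rewrite !in_divisors_of => _; apply: msubsetDl.
rewrite in_divisors_of => km; exists (m `\` k)%mset; last by rewrite msetBBK.
by rewrite in_divisors_of; apply: msubsetDl.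
Qed.

Lemma big_divisors_of_shift l m (F : monom -> R) : (l `<=` m)%mset ->
  \sum_(k <- divisors_of m | (l `<=` k)%mset) F k =
  \sum_(j <- divisors_of (m `\` l)%mset) F (l `+` j)%mset.
Proof.
move=> lm; rewrite -big_filter -[RHS](big_map (msetD l) xpredT F).
apply/perm_big/uniq_perm; rewrite ?filter_uniq ?fset_uniq //.
  rewrite map_inj_uniq ?fset_uniq //.
  exact: can_inj (msetDKB l).
move=> k; rewrite mem_filter in_divisors_of.
apply/andP/mapP => [[lk km]|[j + ->]].
  exists (k `\` l)%mset; last by rewrite msetBDKC.
  by rewrite in_divisors_of msetSB.
rewrite in_divisors_of => jm; split.
  by apply/msubsetP => x; rewrite msetE2 leq_addr.
by rewrite -(msetBDKC lm) msetDS.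
Qed.

Lemma divisors_of_sub k m (F : monom -> R) : (k `<=` m)%mset ->
  \sum_(l <- divisors_of k) F l =
  \sum_(l <- divisors_of m | (l `<=` k)%mset) F l.
Proof.
move=> km; rewrite -[RHS]big_filter.
apply/perm_big/uniq_perm; rewrite ?filter_uniq ?fset_uniq // => l.
rewrite mem_filter !in_divisors_of; case: (boolP (l `<=` k)%mset) => //= lk.
by rewrite (msubset_trans lk km).
Qed.

Fact fpsMC : commutative (@fpsM R).
Proof.
move=> f g; apply: fpsP => m; rewrite !coef_fpsM big_divisors_of_rev.
apply: eq_big_seq => k.
by rewrite in_divisors_of => km; rewrite msetBBK // mulrC.
Qed.

Fact fpsMA : associative (@fpsM R).
Proof.
move=> f g h; apply: fpsP => m; rewrite !coef_fpsM.
pose F l k := coef f l * coef g (k `\` l)%mset * coef h (m `\` k)%mset.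
transitivity (\sum_(k <- divisors_of m)
    \sum_(l <- divisors_of m | (l `<=` k)%mset) F l k); last first.
  apply: eq_big_seq => k.
  rewrite in_divisors_of => km.
  rewrite coef_fpsM mulr_suml (divisors_of_sub _ km).
  by apply: eq_bigr.
rewrite (exchange_big_dep xpredT) //=.
apply: eq_big_seq => l.
rewrite in_divisors_of => lm.
rewrite coef_fpsM big_divisors_of_shift // mulr_sumr; apply: eq_bigr => j _.
by rewrite /F mulrA msetDKB msetBDA.
Qed.

Fact fps1M : left_id fps1 (@fpsM R).
Proof.
move=> f; apply: fpsP => m; rewrite coef_fpsM.
rewrite (big_fsetD1 mset0) ?in_divisors_of ?msub0set //=.
rewrite eqxx mul1r msetB0 big1_fset ?addr0 // => k.
by rewrite !inE /= => /andP[/negPf-> _] _; rewrite mul0r.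
Qed.

Fact fpsMDl : left_distributive (@fpsM R) fpsD.
Proof.
move=> f g h; apply: fpsP => m; rewrite /= !coef_fpsM -big_split.
by apply: eq_bigr => k _; rewrite mulrDl.
Qed.

Fact fps1_neq0 : fps1 != 0 :> fps R.
Proof.
apply/eqP => /(congr1 (fun f => coef f mset0)) /= /eqP.
by rewrite eqxx oner_eq0.
Qed.

HB.instance Definition _ := GRing.Zmodule_isComNzRing.Build (fps R)
  fpsMA fpsMC fps1M fpsMDl fps1_neq0.

Fact fpsZA a b f : fpsZ a (fpsZ b f) = fpsZ (a * b) f.
Proof. by apply: fpsP => m; rewrite /= mulrA. Qed.
Fact fps1Z : left_id 1 fpsZ.
Proof. by move=> f; apply: fpsP => m; rewrite /= mul1r. Qed.
Fact fpsZDr : right_distributive fpsZ +%R.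
Proof. by move=> a f g; apply: fpsP => m; rewrite /= mulrDr. Qed.
Fact fpsZDl f : {morph fpsZ^~ f : a b / a + b}.
Proof. by move=> a b; apply: fpsP => m; rewrite /= mulrDl. Qed.

HB.instance Definition _ := GRing.Zmodule_isLmodule.Build R (fps R)
  fpsZA fps1Z fpsZDr fpsZDl.

Fact fpsZAl a f g : a *: (f * g) = (a *: f) * g.
Proof.
apply: fpsP => m; rewrite /= !coef_fpsM mulr_sumr.
by apply: eq_bigr => k _; rewrite mulrA.
Qed.

HB.instance Definition _ := GRing.Lmodule_isLalgebra.Build R (fps R) fpsZAl.
HB.instance Definition _ := GRing.Lalgebra_isComAlgebra.Build R (fps R).

Definition fps_unit : pred (fps R) := fun f => `[< exists g, g * f = 1 >].
Definition fps_inv f : fps R := xget f [set g | g * f = 1].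

Fact fps_mulVr : {in fps_unit, left_inverse 1 fps_inv *%R}.
Proof.
move=> f /asboolP[g gf1]; rewrite /fps_inv.
by case: xgetP => [h _ //|/(_ g)].
Qed.
Fact fps_unitP f g : g * f = 1 -> fps_unit f.
Proof. by move=> gf1; apply/asboolP; exists g. Qed.
Fact fps_inv_out : {in [predC fps_unit], fps_inv =1 id}.
Proof.
move=> f /negP fU; rewrite /fps_inv.
by case: xgetP => [h _ hf1|//]; case: fU; apply: fps_unitP hf1.
Qed.

HB.instance Definition _ := GRing.ComNzRing_hasMulInverse.Build (fps R)
  fps_mulVr fps_unitP fps_inv_out.

Lemma coef_fvarM i f m :
  coef (fvar i * f) m = if i \in m then coef f (m `\ i)%mset else 0.
Proof.
rewrite [LHS]coef_fpsM; case: ifPn => im.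
  rewrite (big_fsetD1 [mset i]%mset) ?in_divisors_of ?msub1set //=.
  rewrite coef_fvar eqxx mul1r big1_fset ?addr0 // => k.
  by rewrite coef_fvar !inE => /andP[/negPf-> _] _; rewrite mul0r.
rewrite big1_fset // => k; rewrite in_divisors_of => km _.
rewrite coef_fvar; case: eqP => [ki|_]; last by rewrite mul0r.
by move: km im; rewrite ki msub1set => ->.
Qed.

Lemma unit_fps1BZ a i : 1 - a *: fvar i \is a GRing.unit.
Proof.
pose g : fps R := Fps (fun m => if m == msetn (size m) i
                                then a ^+ size m else 0).
apply/unitrPr; exists g.
rewrite mulrBl mul1r -scalerAl; apply: fpsP => m.
change (coef g m - a * coef (fvar i * g) m = (m == mset0)%:R).
rewrite coef_fvarM; have [->|m0] := eqVneq m mset0.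
  by rewrite in_mset0 mulr0 subr0 /g /= size_mset0 msetn0 eqxx.
case: ifPn => im.
  have mE : m = (i +` (m `\ i))%mset by rewrite msetB1K.
  have szm : size m = (size (m `\ i)%mset).+1.
    rewrite {1}mE -[RHS]/(size (i :: (m `\ i)%mset)).
    apply: perm_size; rewrite /perm_eq; apply/allP => x _ /=.
    by rewrite !count_mem_mset mset1DE [x == i]eq_sym.
  rewrite /g /= szm; set n := size _.
  have -> : (m == msetn n.+1 i) = ((m `\ i)%mset == msetn n i).
    apply/eqP/eqP => e.
      rewrite e; apply/msetP => x; rewrite msetB1E !msetnE.
      by case: eqP => //= _; rewrite subn1.
    by rewrite mE e; apply/msetP => x; rewrite mset1DE !msetnE; case: eqP.
  by case: ifP => _; rewrite ?exprS ?subrr // mulr0 subrr.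
rewrite mulr0 subr0 /g /=; case: eqP => // e.
move: im m0; rewrite e in_msetn eqxx andbT -eqn0Ngt => /eqP ->.
by rewrite msetn0 eqxx.
Qed.

Lemma fvarB_lreg (i j : nat) : i != j -> GRing.lreg (fvar i - fvar j : fps R).
Proof.
move=> ij f g /eqP; rewrite -subr_eq0 -mulrBr => /eqP e.
apply/eqP; rewrite -subr_eq0; apply/eqP; move: (f - g) e => {f g} f.
rewrite mulrBl => /eqP; rewrite subr_eq0 => /eqP e; apply: fpsP => m /=.
have step k : coef f k = if j \in k then coef f (i +` (k `\ j))%mset else 0.
  have : coef (fvar i * f) (i +` k)%mset = coef (fvar j * f) (i +` k)%mset.
    exact: (congr1 (fun h => coef h _) e).
  rewrite !coef_fvarM mset1D1 msetD1K => ->.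
  rewrite in_mset1D eq_sym (negPf ij) /=; case: ifP => // jk.
  congr (coef f _); apply/msetP => x; rewrite !(mset1DE, msetB1E).
  case: (eqVneq x j) => [->|_]; last by rewrite !subn0.
  by rewrite eq_sym (negPf ij).
elim: {m}(m j) {-2}m (erefl (m j)) => [|n IHn] m mj; rewrite step.
  by rewrite in_mset mj.
rewrite in_mset mj; apply: IHn.
by rewrite mset1DE msetB1E eqxx eq_sym (negPf ij) mj subn1.
Qed.

(* The quotient of f by g when g divides f.  It is used only for a g that is
   not a zero divisor, so that the quotient is unique (see exquoE, vdm_lreg). *)
Definition exquo f g : fps R := xget 0 [set q | q * g = f].

Lemma exquoE f g q : GRing.lreg g -> q * g = f -> exquo f g = q.
Proof.
move=> greg qg; rewrite /exquo; case: xgetP => [h _ hg|/(_ q)/(_ qg)//].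
by apply: greg; rewrite mulrC hg -qg mulrC.
Qed.

(* The number n of the variables x_0, ..., x_(n-1) needed to write m *)
Definition nvars (m : monom) : nat := (\max_(i <- (m : seq nat)) i.+1)%N.

(* The power series in infinitely many variables with specializations F n at
   x_n = x_(n+1) = ... = 0, for a family F compatible with x_n := 0. *)
Definition stable_limit (F : nat -> fps R) : fps R :=
  Fps (fun m => coef (F (nvars m)) m).

(* h_k(y_0, y_1, ...) and e_k(y_0, y_1, ...), where x_i divides y_i *)
Definition hsymf (k : nat) (y : nat -> fps R) : fps R :=
  stable_limit (fun n => \sum_(t : k.-tuple 'I_n | sorted leq (map val t))
                           \prod_(i <- t) y i).
Definition esymf (k : nat) (y : nat -> fps R) : fps R :=
  stable_limit (fun n => \sum_(t : k.-tuple 'I_n | sorted ltn (map val t))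
                           \prod_(i <- t) y i).

(* Summability in the product topology of the discrete topologies on R: each
   coefficient of the partial sums over finite sets B of indices is the
   coefficient of s as soon as B is large enough. *)
Definition sums_to (I : choiceType) (P : pred I) (u : I -> fps R) (s : fps R) :=
  forall m, exists A : {fset I}, forall B : {fset I}, (A `<=` B)%fset ->
    \sum_(i <- B | P i) coef (u i) m = coef s m.

End FpsRing.

Definition is_partition (s : seq nat) := sorted geq s && (0%N \notin s).

Record intpart := IntPart {
  parts :> seq nat;
  parts_is_partition : is_partition parts
}.
HB.instance Definition _ := [isSub for parts].
HB.instance Definition _ := [Choice of intpart by <:].

Definition part (lam : intpart) (i : nat) : nat := nth 0%N lam i.

Fact one_row_is_partition (k : nat) : is_partition (nseq (0 < k) k).
Proof. by case: k. Qed.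
Definition one_row (k : nat) := IntPart (one_row_is_partition k).

Fact one_column_is_partition (k : nat) : is_partition (nseq k 1%N).
Proof.
rewrite /is_partition mem_nseq andbF andbT.
by case: k => //= k; elim: k.
Qed.
Definition one_column (k : nat) := IntPart (one_column_is_partition k).

Definition included (lam mu : intpart) : bool :=
  all (fun i => part lam i <= part mu i)%N (iota 0 (size lam)).

Section SkewShape.
Variables mu lam : intpart.

(* boxes (row, column) of mu/lam, numbered from 0 *)
Definition boxes : seq (nat * nat) :=
  [seq (i, j) | i <- iota 0 (size mu),
                j <- iota (part lam i) (part mu i - part lam i)].

Definition adjacent (u v : nat * nat) : bool :=
  ((u.1 == v.1) && ((u.2.+1 == v.2) || (v.2.+1 == u.2))) ||
  ((u.2 == v.2) && ((u.1.+1 == v.1) || (v.1.+1 == u.1))).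

Definition nboxes : nat := size boxes.
Definition nrows : nat := size (undup (map fst boxes)).
Definition ncols : nat := size (undup (map snd boxes)).
Definition ncomps : nat :=
  n_comp (fun u v : seq_sub boxes => adjacent (val u) (val v)) predT.
Definition ninner : int :=
  nboxes%:Z - ncols%:Z - nrows%:Z + ncomps%:Z.

Definition horizontal_strip : bool := uniq (map snd boxes).
Definition vertical_strip : bool := uniq (map fst boxes).

End SkewShape.

(* n(n-1)...(n-m+1)/m! for m >= 0, and 0 for m < 0 *)
Definition binomz (n m : int) : int :=
  match m, n with
  | Negz _, _ => 0
  | Posz m, Posz n => 'C(n, m)%:Z
  | Posz m, Negz n => (-1) ^+ m * 'C(n + m, m)%:Z
  end.

Section Grothendieck.
Variables (R : comNzRingType) (a b : R).
Implicit Type lam : intpart.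

Definition Gnum (n : nat) lam : fps R :=
  \det (\matrix_(i < n, j < n)
    (fvar i ^+ (part lam j + (n - j.+1)) * (1 + b *: fvar i) ^+ j
     / (1 - a *: fvar i) ^+ part lam j)).

Definition vdm (n : nat) : fps R :=
  \prod_(i < n) \prod_(j < n | (i < j)%N) (fvar i - fvar j).

Lemma vdm_lreg n : GRing.lreg (vdm n).
Proof.
have prod_lreg (I : finType) (P : pred I) (F : I -> fps R) :
    (forall i, P i -> GRing.lreg (F i)) -> GRing.lreg (\prod_(i | P i) F i).
  by move=> FP; elim/big_ind: _ => //; [exact: lreg1|exact: lregM].
apply: (prod_lreg) => i _; apply: (prod_lreg) => j ij.
by apply: fvarB_lreg; rewrite neq_ltn ij.
Qed.

Definition Gfin (n : nat) lam : fps R := exquo (Gnum n lam) (vdm n).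

(* The determinantal formula in n variables is the right one (and is stable)
   only from n = size lam on. *)
Definition G lam : fps R :=
  stable_limit (fun n => Gfin (maxn (size lam) n) lam).

End Grothendieck.

(* In the two coefficients below, an exponent is negative only if the binomial
   coefficient is 0. *)
Definition vcoef (R : comUnitRingType) (a b : R) (k : nat)
    (mu lam : intpart) : R :=
  let r := (nrows mu lam)%:Z in let c := (ncols mu lam)%:Z in
  let p := (ncomps mu lam)%:Z in
  if included lam mu then
    b ^ (r - p) * (a + b) ^ (ninner mu lam) * a ^ (c - k%:Z)
      * (binomz (c - p) (c - k%:Z))%:~R
  else 0.

Definition vbarcoef (R : comUnitRingType) (a b : R) (k : nat)
    (mu lam : intpart) : R :=
  let r := (nrows mu lam)%:Z in let c := (ncols mu lam)%:Z in
  let p := (ncomps mu lam)%:Z in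
  if included lam mu then
    a ^ (c - p) * (a + b) ^ (ninner mu lam) * b ^ (r - k%:Z)
      * (binomz (r - p) (r - k%:Z))%:~R
  else 0.

Definition Zab : idomainType := {mpoly int[2]}.
Definition alpha : Zab := 'X_(@ord0 1).
Definition beta : Zab := 'X_(@ord_max 1).

(* Main.v *)
(* Put y_i = x_i / (1 - a x_i), g = -(a + b) and q_ij = x_i^(n-j) (1 + b x_i)^(j-1).
   The numerator of G_lam is det[y_i^lam_j q_ij], and y q_{j+1} = (1 - g y) q_j.
   All six formulas follow from one Pieri rule with two parameters u and w:
     prod_i (1 + u y_i) / (1 - w y_i) * G_lam
       = sum_(mu >= lam) (g + u)^(r - p) g^i (w + u)^p w^(c - p) G_mu,
   where r, c, p, i count the rows, columns, components and inner squares of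
   mu/lam.  The weight is a product over the rows of mu of factors W_j(mu_j).
   Up to the factor (1 + u y) / (1 - w y), the column sum_m W_j(m) y^m q_j is
   y^lam_j q_j plus a multiple of the previous column, so the determinant of these
   columns is the left-hand side.  Expanding it gives the right-hand side, because
   the terms with mu_(j+1) > mu_j cancel: W_(j+1) is geometric in that range and
   sum_(m > l) g^(m-l-1) y^m q_(j+1) = y^l q_j.
   The formulas with h_k and e_k are coefficients of t^k for u, w affine in t; those
   with G_(k) and G_(1^k) come from comparing the cases lam and empty for u = -g,
   w = t and for w = 0, u = t - g.
   Infinite sums are avoided by working modulo power series of high order, where
   the y_i are nilpotent. *)
From HB Require Import structures.
Require Import Defs.
From mathcomp Require Import all_boot all_order all_algebra.
From mathcomp Require Import finmap multiset mpoly.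
From mathcomp Require Import boolp fingroup perm generic_quotient ring_quotient.
From mathcomp Require Import zify ring.

Set Implicit Arguments.
Unset Strict Implicit.
Unset Printing Implicit Defensive.

Import GRing.Theory.

Local Open Scope nat_scope.

(** * Statistics of skew shapes *)

Lemma part_default (lam : intpart) j : size lam <= j -> part lam j = 0.
Proof. exact: nth_default. Qed.

Lemma ipart_gt0 (lam : intpart) j : j < size lam -> 0 < part lam j.
Proof.
case: lam => s hs /= js; rewrite lt0n; apply/eqP => h.
by case/andP: (hs) => _ /negP[]; rewrite -h mem_nth.
Qed.

Lemma part_leq (lam : intpart) i j : i <= j -> part lam j <= part lam i.
Proof.
move=> ij; have [jl|lj] := ltnP j (size lam); last by rewrite part_default.
case: lam jl => s /= hs js; have /andP[ss _] := hs.
have tr : transitive geq by move=> b a c /=; lia.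
by apply: (sorted_leq_nth tr leqnn 0 ss) => //; rewrite inE; lia.
Qed.

Lemma intpart_eqP (lam mu : intpart) : part lam =1 part mu -> lam = mu.
Proof.
move=> e; apply: val_inj => /=; apply: (@eq_from_nth _ 0) => [|i _]; last exact: e.
apply/eqP; rewrite eqn_leq; apply/andP; split; rewrite leqNgt; apply/negP => h.
  by have := ipart_gt0 h; rewrite e part_default.
by have := ipart_gt0 h; rewrite -e part_default.
Qed.

Lemma includedP (lam mu : intpart) :
  reflect (forall j, part lam j <= part mu j) (included lam mu).
Proof.
apply: (iffP allP) => [h j|h j _]; last exact: h.
have [jl|lj] := ltnP j (size lam); last by rewrite part_default.
by apply: h; rewrite mem_iota.
Qed.

Section Skew.
Variables mu lam : intpart.
Hypothesis lam_mu : included lam mu.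

Definition rlen j := part mu j - part lam j.
(* number of boxes in row [j] lying directly below a box of row [j.-1] *)
Definition ovl j := if j is i.+1 then part mu j - part lam i else 0.

Let le_lm j : part lam j <= part mu j. Proof. exact/includedP. Qed.

Lemma ovl_le j : ovl j <= rlen j.
Proof. by case: j => //= j; rewrite /rlen leq_sub2l // part_leq. Qed.

Lemma ovl_gt0 j : 0 < ovl j.+1 -> 0 < rlen j.
Proof. by rewrite /= /rlen; have := part_leq mu (leqnSn j); lia. Qed.

Lemma mem_boxes u :
  (u \in boxes mu lam) = (part lam u.1 <= u.2 < part mu u.1).
Proof.
case: u => i j /=; apply/allpairsPdep/idP => [[i' [j' []]]|h].
  by rewrite !mem_iota /= => hi hj [-> ->]; lia.
exists i, j; split => //; rewrite mem_iota; last by lia.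
rewrite leq0n add0n ltnNge; apply/negP => /(part_default) h0.
by move: h; rewrite h0 ltn0 andbF.
Qed.

(** Rows from [size mu] on are empty, so each statistic is a sum over any [n >= size mu] rows; [n]
    will later be the number of variables. *)
Let sum_extend n (F : nat -> nat) : size mu <= n ->
  (forall j, rlen j = 0 -> F j = 0) ->
  \sum_(j < n) F j = \sum_(j <- iota 0 (size mu)) F j.
Proof.
move=> sn F0; rewrite -(big_mkord xpredT F) (big_cat_nat (n := size mu)) //=.
rewrite [X in _ + X]big_nat_cond [X in _ + X]big1 ?addn0; last first.
  by move=> j /andP[/andP[h _] _]; apply: F0; rewrite /rlen part_default.
by rewrite /index_iota subn0.
Qed.

Lemma nboxesE n : size mu <= n -> nboxes mu lam = \sum_(j < n) rlen j.
Proof.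
move=> sn; rewrite sum_extend // /nboxes /boxes size_allpairs_dep sumnE big_map.
by apply: eq_bigr => j _; rewrite size_iota.
Qed.

Let sum_bool (P : pred nat) s : \sum_(j <- s) (P j : nat) = size (filter P s).
Proof. by rewrite size_filter -sum1_count [RHS]big_mkcond. Qed.

Lemma nrowsE n : size mu <= n -> nrows mu lam = \sum_(j < n) (0 < rlen j).
Proof.
move=> sn; rewrite (@sum_extend n (fun j => 0 < rlen j)) // => [|j ->//].
rewrite (sum_bool (fun j => 0 < rlen j)).
apply/perm_size/uniq_perm; rewrite ?undup_uniq ?filter_uniq ?iota_uniq // => j.
rewrite mem_undup mem_filter mem_iota /=; apply/mapP/andP => [[[i c]]|[]].
  rewrite mem_boxes /= => h ->; split; first by rewrite /rlen; lia.
  by rewrite ltnNge; apply/negP => /(part_default) h0; move: h; rewrite h0; lia.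
by move=> h _; exists (j, part lam j); rewrite // mem_boxes /= leqnn -subn_gt0.
Qed.

(** Each nonempty column is counted at its top box. For [j > 0], a box of row [j] lies below another
    one exactly when its column is at least [part lam j.-1], so the top boxes are the first
    [rlen j - ovl j] boxes of the row. *)
Lemma ncolsE n : size mu <= n -> ncols mu lam = \sum_(j < n) (rlen j - ovl j).
Proof.
move=> sn; rewrite (@sum_extend n (fun j => rlen j - ovl j)) // => [|j ->//].
pose s := flatten [seq iota (part lam j) (rlen j - ovl j) | j <- iota 0 (size mu)].
have -> : \sum_(j <- iota 0 (size mu)) (rlen j - ovl j) = size s.
  rewrite size_flatten sumnE !big_map.
  by apply: eq_bigr => j _; rewrite size_iota.
have rowE j c : (c \in iota (part lam j) (rlen j - ovl j)) =
    (part lam j <= c < part mu j) && ((0 < j) ==> (c < part lam j.-1)).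
  rewrite mem_iota /rlen; have := le_lm j; case: j => [|j] /=; first by lia.
  by have := part_leq lam (leqnSn j); lia.
apply/perm_size/uniq_perm; rewrite ?undup_uniq //.
  rewrite /s; elim: (size mu) => [|m IH] //.
  rewrite -addn1 iotaD map_cat flatten_cat cat_uniq IH /= cats0 iota_uniq andbT.
  apply/hasPn => c; rewrite add0n rowE => /andP[cm mc].
  apply/negP => /flatten_mapP[j]; rewrite mem_iota rowE => /andP[_ jm].
  move=> /andP[/andP[jc _] _]; case: m mc jm {IH cm} => //= m mc jm.
  by have := part_leq lam (_ : j <= m); lia.
move=> c; rewrite mem_undup; apply/mapP/flatten_mapP => [[[i c'] + ->]|[j]].
  rewrite mem_boxes /= => /andP[ic ci].
  (* The top box of column [c'] lies in the first row [j] with [part lam j <= c']. *)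
  have ex : exists j, part lam j <= c' by exists i.
  case: (ex_minnP ex) => j jc jmin; have ji := jmin _ ic.
  have mji := part_leq mu ji.
  exists j.
    rewrite mem_iota /= add0n ltnNge; apply/negP => /(part_default) h0.
    by move: (leq_trans ci mji); rewrite h0.
  rewrite rowE jc (leq_trans ci mji) /=; apply/implyP => j0.
  by rewrite ltnNge; apply/negP => /jmin; rewrite leqNgt prednK ?leqnn.
move=> _; rewrite rowE => /andP[h _]; exists (j, c) => //.
by rewrite mem_boxes.
Qed.

(** The sum of the overlaps is the excess of the number of boxes over the number of nonempty
    columns. *)
Lemma horizontal_stripE n : size mu <= n ->
  horizontal_strip mu lam = (\sum_(j < n) ovl j == 0).
Proof.
move=> sn; apply/negb_inj; rewrite -[~~ horizontal_strip _ _]ltn_size_undup.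
rewrite -/(ncols mu lam) size_map -/(nboxes mu lam) (ncolsE sn) (nboxesE sn).
have -> : \sum_(j < n) rlen j = \sum_(j < n) (rlen j - ovl j) + \sum_(j < n) ovl j.
  by rewrite -big_split; apply: eq_bigr => j _; rewrite /= subnK ?ovl_le.
by rewrite -[X in X < _]addn0 ltn_add2l lt0n.
Qed.

Lemma vertical_stripE n : size mu <= n ->
  vertical_strip mu lam = (\sum_(j < n) (rlen j).-1 == 0).
Proof.
move=> sn; apply/negb_inj; rewrite -[~~ vertical_strip _ _]ltn_size_undup.
rewrite -/(nrows mu lam) size_map -/(nboxes mu lam) (nrowsE sn) (nboxesE sn).
have -> : \sum_(j < n) rlen j = \sum_(j < n) (0 < rlen j) + \sum_(j < n) (rlen j).-1.
  by rewrite -big_split; apply: eq_bigr => j _ /=; case: (rlen j).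
by rewrite -[X in X < _]addn0 ltn_add2l lt0n.
Qed.

(** Climbs as long as the row overlaps the preceding one. For a nonempty row the result is the top
    row of its component, and it serves as a label of that component. *)
Let row_top := fix row_top j :=
  if j is i.+1 then if 0 < ovl j then row_top i else j else 0.

Let row_topS j : row_top j.+1 = if 0 < ovl j.+1 then row_top j else j.+1.
Proof. by []. Qed.

Let row_topP j : 0 < rlen j -> 0 < rlen (row_top j) /\ ovl (row_top j) = 0.
Proof.
elim: j => [//|j IH] h; rewrite row_topS; case: ifP => [/ovl_gt0|/negbT].
  exact: IH.
by rewrite -eqn0Ngt => /eqP.
Qed.

Let e := fun u v : seq_sub (boxes mu lam) => adjacent (val u) (val v).

Let e_sym : ssrbool.symmetric e.
Proof.
by move=> u v; rewrite /e /adjacent; lia.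
Qed.

Let e_csym : connect_sym e. Proof. exact: sym_connect_sym e_sym. Qed.

(** Connectedness transported from [seq_sub] to plain coordinates, so that paths can be described
    without membership proofs. *)
Let linked u v := exists2 x : seq_sub (boxes mu lam), val x = u &
  exists2 z : seq_sub (boxes mu lam), val z = v & connect e x z.

Let linked_trans v u t : linked u v -> linked v t -> linked u t.
Proof.
move=> [x xu [z zv xz]] [z' z'v [r rt zr]]; exists x => //; exists r => //.
apply: connect_trans xz _; suff -> : z = z' by [].
by apply: val_inj; rewrite zv z'v.
Qed.

Let linked_adj u v : u \in boxes mu lam -> v \in boxes mu lam ->
  adjacent u v -> linked u v.
Proof.
move=> hu hv a; exists (SeqSub hu) => //; exists (SeqSub hv) => //.
exact: connect1.
Qed.

Let linked_row i c d : part lam i <= c -> d <= c -> part lam i <= d ->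
  c < part mu i -> linked (i, c) (i, d).
Proof.
elim: c => [|c IH] h1 h2 h3 h4.
  have -> : d = 0 by lia.
  have b : (i, 0) \in boxes mu lam by rewrite mem_boxes /=; lia.
  by exists (SeqSub b) => //; exists (SeqSub b).
have b : (i, c.+1) \in boxes mu lam by rewrite mem_boxes /=; lia.
have [->|dc] := eqVneq d c.+1.
  by exists (SeqSub b) => //; exists (SeqSub b).
apply: (@linked_trans (i, c)); last by apply: IH; lia.
apply: linked_adj => //; first by rewrite mem_boxes /=; lia.
by rewrite /adjacent /= !eqxx orbT.
Qed.

(** The first box of the top row represents the component. If row [i.+1] overlaps row [i], then
    column [part lam i] meets both rows and gives the passage upwards. *)
Let linked_top i c : (i, c) \in boxes mu lam ->
  linked (i, c) (row_top i, part lam (row_top i)).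
Proof.
elim: i c => [|i IH] c; rewrite mem_boxes => /andP[h1 h2]; simpl in h1, h2.
  by rewrite -[row_top 0]/0; apply: linked_row; lia.
rewrite row_topS; case: ifP => [o|_]; last by apply: linked_row; lia.
simpl in o.
have l1 := part_leq lam (leqnSn i); have m1 := part_leq mu (leqnSn i).
have b1 : (i.+1, part lam i) \in boxes mu lam by rewrite mem_boxes /=; lia.
have b2 : (i, part lam i) \in boxes mu lam by rewrite mem_boxes /=; lia.
apply: linked_trans (IH _ b2); apply: (@linked_trans (i.+1, part lam i)); last first.
  by apply: linked_adj => //; rewrite /adjacent /= !eqxx !orbT.
have [?|?] := leqP (part lam i) c; first by apply: linked_row; lia.
(* [linked_row] only moves to the left; a move to the right is its reverse. *)
have [x hx [z hz xz]] : linked (i.+1, part lam i) (i.+1, c).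
  by apply: linked_row; lia.
by exists z => //; exists x => //; rewrite e_csym.
Qed.

Let top_of (x : seq_sub (boxes mu lam)) := row_top (val x).1.

(** Vertically adjacent boxes force an overlap of their rows, so [top_of] is constant along paths;
    conversely, both boxes are linked to the first box of the same top row. *)
Let connect_top x z : connect e x z = (top_of x == top_of z).
Proof.
apply/idP/eqP => [|xz].
  case/connectP => p; elim: p x => [|v p IH] x /= => [_ ->//|/andP[xv hp] hz].
  rewrite -(IH v hp hz) {IH hp hz}; move: xv (ssvalP x) (ssvalP v).
  rewrite /e /adjacent /top_of /= !mem_boxes.
  case: (ssval x) (ssval v) => [i c] [j d] /=.
  have step k l : l < part mu k.+1 -> part lam k <= l -> row_top k.+1 = row_top k.
    by rewrite row_topS /= => h1 h2; rewrite ifT //; lia.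
  case/orP => [/andP[/eqP-> //]|/andP[/eqP-> /orP[]/eqP<- h1 h2]].
    by apply/esym/(step _ d); lia.
  by apply: (step _ d); lia.
have to_top v : exists2 r : seq_sub (boxes mu lam),
    val r = (top_of v, part lam (top_of v)) & connect e v r.
  have hv : ((val v).1, (val v).2) \in boxes mu lam.
    by rewrite -surjective_pairing; exact: ssvalP.
  have [v' hv' [r hr vr]] := linked_top hv; exists r => //.
  by have -> : v = v' by apply: val_inj; rewrite hv' -surjective_pairing.
have [[r hr xr] [t ht zt]] := (to_top x, to_top z).
apply: connect_trans xr _; rewrite e_csym; suff -> : r = t by [].
by apply: val_inj; rewrite hr ht xz.
Qed.

(** Components correspond to the values of [top_of], which are the nonempty rows without overlap. *)
Lemma ncompsE n : size mu <= n ->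
  ncomps mu lam = \sum_(j < n) ((0 < rlen j) && (ovl j == 0)).
Proof.
move=> sn; rewrite (@sum_extend n (fun j => (0 < rlen j) && (ovl j == 0))) //; last first.
  by move=> j ->.
rewrite (sum_bool (fun j => (0 < rlen j) && (ovl j == 0))) /ncomps -/e.
have -> : n_comp e predT = size (undup [seq top_of x | x <- enum (roots e)]).
  rewrite undup_id; last first.
    rewrite map_inj_in_uniq ?enum_uniq // => x z; rewrite !mem_enum => /eqP rx /eqP rz.
    by move=> /eqP; rewrite -connect_top => /(fingraph.rootP e_csym); rewrite rx rz.
  rewrite size_map -cardE; apply: eq_card => x.
  by rewrite !inE andbT.
apply/perm_size/uniq_perm; rewrite ?undup_uniq ?filter_uniq ?iota_uniq // => j.
rewrite mem_undup mem_filter mem_iota /= add0n.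
apply/mapP/andP => [[x _ ->]|[/andP[r0 /eqP o0] _]].
  have := ssvalP x; rewrite /top_of /= mem_boxes.
  case: (ssval x) => i c /= h; have ri : 0 < rlen i by rewrite /rlen; lia.
  have [r0 ->] := row_topP ri; rewrite r0; split=> //.
  by rewrite ltnNge; apply/negP => /part_default h0; move: r0; rewrite /rlen h0.
have b : (j, part lam j) \in boxes mu lam.
  by rewrite mem_boxes /=; move: r0; rewrite /rlen; lia.
exists (fingraph.root e (SeqSub b)); first by rewrite mem_enum; exact: roots_root e_csym _.
have /eqP <- : top_of (SeqSub b) == top_of (fingraph.root e (SeqSub b)).
  by rewrite -connect_top connect_root.
by rewrite /top_of /=; case: (j) o0 => // i o0; rewrite row_topS o0.
Qed.

End Skew.

Local Open Scope ring_scope.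

(** * The determinantal Pieri rule *)

Definition decreasing n (f : 'I_n -> nat) : bool :=
  [forall j : 'I_n, forall k : 'I_n, (k == j.+1 :> nat) ==> (f k <= f j)%N].

Section Weight.
Variables (A : comNzRingType) (g u w : A).

(* [m] is the length of row [j] of the larger shape. *)
Definition row_weight (lam : nat -> nat) (j m : nat) : A :=
  if (m < lam j)%N then 0 else if m == lam j then 1 else
  if (0 < j)%N && (lam j.-1 < m)%N
  then (g + u) * g ^+ (m - (lam j.-1).+1) * w ^+ (lam j.-1 - lam j)
  else (w + u) * w ^+ (m - (lam j).+1).

End Weight.

Section Pieri.
Variables (A : comNzRingType) (n M : nat) (y : 'I_n -> A) (q : 'I_n -> nat -> A).
Variables (g u w : A) (lam : nat -> nat).
Hypothesis y_nil : forall i, y i ^+ M = 0.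
Hypothesis y_q : forall i j, (j.+1 < n)%N ->
  y i * q i j.+1 = (1 - g * y i) * q i j.
Hypothesis lam_decr : forall j, (lam j.+1 <= lam j)%N.

(** The truncation of [x ^+ l.+1 / (1 - c * x)]. The indicator factor, in place of a range
    condition, lets sums with different [l] be combined term by term. *)
Let geom (c x : A) l :=
  \sum_(m < M) (l < m)%N%:R * (c ^+ (m - l.+1) * x ^+ m).

Let geom_cond (c x : A) l :
  geom c x l = \sum_(m < M | (l < m)%N) c ^+ (m - l.+1) * x ^+ m.
Proof.
rewrite /geom [RHS]big_mkcond; apply: eq_bigr => m _.
by case: ifP; rewrite (mul1r, mul0r).
Qed.

Let geomE0 (c x : A) l N :
  (1 - c * x) * \sum_(m < N | (l < m)%N) c ^+ (m - l.+1) * x ^+ m =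
  if (l < N)%N then x ^+ l.+1 - c ^+ (N - l.+1) * x ^+ N else 0.
Proof.
elim: N => [|N IH]; first by rewrite big_ord0 mulr0.
rewrite big_mkcond big_ord_recr -big_mkcond /= mulrDr IH ltnS.
case: (ltngtP l N) => [lN|lN|->].
- have -> : (N.+1 - l.+1 = (N - l.+1).+1)%N by lia.
  by rewrite !exprS; ring.
- by rewrite mulr0 addr0.
by rewrite mulr0 addr0 subnn expr0 mul1r subrr.
Qed.

Let geomE (c x : A) l : x ^+ M = 0 -> (1 - c * x) * geom c x l = x ^+ l.+1.
Proof.
move=> xM; rewrite geom_cond geomE0 xM mulr0 subr0; case: ltnP => // lM.
by rewrite -(subnKC (leqW lM)) exprD xM mul0r.
Qed.

(** As [x] is nilpotent, the finite geometric sum is an inverse. *)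
Let unit1 (c x : A) : x ^+ M = 0 -> GRing.lreg (1 - c * x).
Proof.
move=> xM f h e.
suff H z : (\sum_(m < M) c ^+ m * x ^+ m) * ((1 - c * x) * z) = z.
  by rewrite -[f]H -[h]H e.
have : (1 - c * x) * \sum_(m < M) (c * x) ^+ m = 1.
  by rewrite -opprB mulNr -subrX1 opprB exprMn xM mulr0 subr0.
under eq_bigr do rewrite exprMn.
by move=> H; rewrite mulrA [_ * (1 - _)]mulrC H mul1r.
Qed.

(** After multiplication by the regular element [1 - g * y i], this is [y_q] times [y i ^+ l]. *)
Let geom_q i j l : (j.+1 < n)%N -> geom g (y i) l * q i j.+1 = y i ^+ l * q i j.
Proof.
move=> jn; apply: (unit1 (c := g) (y_nil i)).
by rewrite mulrA geomE // exprSr -mulrA y_q //; ring.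
Qed.

Let Fcol i j := \sum_(m < M) row_weight g u w lam j m * y i ^+ m.

(** The tail of ratio [w] is first run over all [m > lam j]; for [j > 0] the part beyond [lam j.-1]
    is then replaced by the tail of ratio [g]. *)
Let FcolE i j : Fcol i j = y i ^+ lam j + (w + u) * geom w (y i) (lam j) +
  (0 < j)%N%:R * w ^+ (lam j.-1 - lam j) *
   ((g + u) * geom g (y i) (lam j.-1) - (w + u) * geom w (y i) (lam j.-1)).
Proof.
have -> : y i ^+ lam j = \sum_(m < M) (m == lam j :> nat)%:R * y i ^+ m.
  have [lM|Ml] := ltnP (lam j) M; last first.
    rewrite -(subnKC Ml) exprD y_nil mul0r big1 // => m _.
    by case: eqP (ltn_ord m) => [|_]; [lia|rewrite mul0r].
  rewrite (bigD1 (Ordinal lM)) //= eqxx mul1r big1 ?addr0 // => m /negPf.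
  by rewrite -val_eqE /= => ->; rewrite mul0r.
rewrite /geom !mulr_sumr -sumrB mulr_sumr.
rewrite -!big_split; apply: eq_bigr => m _ /=; rewrite /row_weight.
have lamj : (lam j <= lam j.-1)%N by case: (j) => //= j'; apply: lam_decr.
case: (ltngtP m (lam j)) => [ml|ml|->].
- have -> : (lam j.-1 < m)%N = false by lia.
  by rewrite /= ?mulr0n ?mulr1n; ring.
- case: j lamj ml => [|j] /= lamj ml; first by rewrite /= ?mulr0n ?mulr1n; ring.
  case: ifP => h; last by rewrite /= ?mulr0n ?mulr1n; ring.
  have -> : (m - (lam j.+1).+1 = (m - (lam j).+1) + (lam j - lam j.+1))%N by lia.
  by rewrite exprD /= ?mulr0n ?mulr1n; ring.
have -> : (lam j.-1 < lam j)%N = false by lia.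
by rewrite /= ?mulr0n ?mulr1n; ring.
Qed.

(** The factor [1 - w * y i] collapses the tails of ratio [w], and [geom_q] turns the tail of ratio
    [g] into the preceding column. What remains is a column operation. *)
Let Fcol_q i j : (j < n)%N -> (1 - w * y i) * (Fcol i j * q i j) =
  (1 + u * y i) * (y i ^+ lam j * q i j +
    (0 < j)%N%:R * ((g - w) * w ^+ (lam j.-1 - lam j)) *
      (y i ^+ lam j.-1 * q i j.-1)).
Proof.
move=> jn; rewrite FcolE.
have e1 := geomE w (lam j) (y_nil i).
have e2 := geomE w (lam j.-1) (y_nil i).
set z := y i in e1 e2 *; set G1 := geom w z (lam j) in e1 *.
set G2 := geom w z _ in e2 *; set G3 := geom g z _.
transitivity ((z ^+ lam j * (1 - w * z) + (w + u) * ((1 - w * z) * G1)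
  + (0 < j)%N%:R * w ^+ (lam j.-1 - lam j) * ((g + u) * G3 * (1 - w * z)
     - (w + u) * ((1 - w * z) * G2))) * q i j); first by ring.
rewrite e1 e2; case: j jn @G3 @G2 e2 @G1 e1 => [|j] jn G3 G2 e2 G1 e1 /=.
  by rewrite exprS; ring.
have e3 : G3 * q i j.+1 = z ^+ lam j * q i j by apply: geom_q.
have e4 : z ^+ (lam j).+1 * q i j.+1 = (1 - g * z) * (z ^+ lam j * q i j).
  by rewrite exprSr -mulrA y_q //; rewrite /z; ring.
transitivity ((z ^+ lam j.+1 * (1 - w * z) + (w + u) * z ^+ (lam j.+1).+1) * q i j.+1
  + w ^+ (lam j - lam j.+1) * ((g + u) * (1 - w * z) * (G3 * q i j.+1)
     - (w + u) * (z ^+ (lam j).+1 * q i j.+1))); first by ring.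
by rewrite e3 e4 exprS; ring.
Qed.

(* the transposes are used so that multilinearity is in the rows *)
Let Det (f : 'I_n -> nat) : A := \det (\matrix_(j, i) (y i ^+ f j * q i j)).

(** By [Fcol_q] the two matrices differ by diagonal factors and by the lower unitriangular matrix
    [U] of the column operations. *)
Lemma det_Fcol : (\prod_i (1 + u * y i)) * Det (fun j => lam j) =
  (\prod_i (1 - w * y i)) * \det (\matrix_(j, i) (Fcol i j * q i j)).
Proof.
pose U : 'M[A]_n := \matrix_(j, k) ((j == k)%:R + (j == k.+1 :> nat)%:R *
  ((g - w) * w ^+ (lam j.-1 - lam j))).
have dU : \det U = 1.
  rewrite det_trig; last first.
    apply/is_trig_mxP => j k jk; rewrite mxE.
    by rewrite -val_eqE /= !ltn_eqF ?mul0r ?add0r // ltnW.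
  by rewrite big1 // => j _; rewrite mxE eqxx ltn_eqF // mul0r addr0.
have dD (F : 'I_n -> A) : \prod_i F i = \det (diag_mx (\row_i F i)).
  by rewrite det_diag; apply: eq_bigr => i _; rewrite mxE.
have -> : Det (fun j => lam j) =
    \det (U *m (\matrix_(j, i) (y i ^+ lam j * q i j))).
  by rewrite det_mulmx dU mul1r.
rewrite !dD mulrC -det_mulmx [RHS]mulrC -det_mulmx; congr (\det _).
apply/matrixP => j i; rewrite !mul_mx_diag !mxE [RHS]mulrC Fcol_q // mulrC.
congr (_ * _).
under [LHS]eq_bigr => k _ do rewrite !mxE mulrDl.
rewrite big_split /= (bigD1 j) //= eqxx mul1r big1 ?addr0; last first.
  by move=> k /negPf kj; rewrite eq_sym kj mul0r.
congr (_ + _); case: j => -[|j] jn /=.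
  by rewrite !mul0r big1 // => k _; rewrite !mul0r.
rewrite (bigD1 (Ordinal (ltnW jn))) //= eqxx big1 ?addr0 // => k /negPf.
by rewrite -val_eqE /= eqSS eq_sym => ->; rewrite !mul0r.
Qed.

Let W (f : 'I_n -> nat) := \prod_(j < n) row_weight g u w lam j (f j).

Let det_Fcol_expand : \det (\matrix_(j, i) (Fcol i j * q i j)) =
  \sum_(f : {ffun 'I_n -> 'I_M}) W (fun j => f j) * Det (fun j => f j).
Proof.
rewrite /determinant /Det /W.
transitivity (\sum_(s : 'S_n) \sum_(f : {ffun 'I_n -> 'I_M})
   \prod_(j < n) row_weight g u w lam j (f j) *
   ((-1) ^+ s * \prod_(j < n) (y (s j) ^+ f j * q (s j) j))).
  apply: eq_bigr => s _.
  transitivity ((-1) ^+ s * \prod_(j < n) \sum_(m < M)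
     (row_weight g u w lam j m * (y (s j) ^+ m * q (s j) j))).
    congr (_ * _); apply: eq_bigr => j _; rewrite mxE /Fcol mulr_suml.
    by apply: eq_bigr => m _; rewrite mulrA.
  rewrite bigA_distr_bigA mulr_sumr; apply: eq_bigr => f _.
  by rewrite big_split /= mulrCA.
rewrite exchange_big; apply: eq_bigr => f _ /=; rewrite -mulr_sumr.
congr (_ * _); apply: eq_bigr => s _; congr (_ * _).
by apply: eq_bigr => j _; rewrite mxE.
Qed.

Let upd (k : 'I_n) (m : 'I_M) (f : {ffun 'I_n -> 'I_M}) : {ffun 'I_n -> 'I_M} :=
  [ffun j => if j == k then m else f j].

(** Functions are grouped by their values away from [k]; the member with value [m0] at [k]
    represents its group. *)
Let big_upd (k : 'I_n) (m0 : 'I_M) (X : {ffun 'I_n -> 'I_M} -> A) :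
  \sum_f X f = \sum_(f : {ffun 'I_n -> 'I_M} | f k == m0) \sum_m X (upd k m f).
Proof.
rewrite (partition_big (upd k m0) (fun f => f k == m0)) /=; last first.
  by move=> f _; rewrite ffunE eqxx.
apply: eq_bigr => f /eqP fk; rewrite (reindex (fun m => upd k m f)) /=; last first.
  exists (fun h : {ffun 'I_n -> 'I_M} => h k) => [m _|h]; first by rewrite ffunE eqxx.
  rewrite inE => /eqP <-; apply/ffunP => j; rewrite !ffunE.
  by case: eqP => // ->.
apply: eq_bigl => m; apply/eqP/ffunP => j; rewrite !ffunE.
by case: eqP => // ->.
Qed.

(* The terms in which row [k.+1] is longer than row [k] add up to a
   determinant with two equal rows. *)
Let violation_sum (k k' : 'I_n) (P : pred {ffun 'I_n -> 'I_M}) :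
  k' = k.+1 :> nat -> (forall f m, P (upd k' m f) = P f) ->
  \sum_(f : {ffun 'I_n -> 'I_M} | P f && (f k < f k')%N) 
    W (fun j => f j) * Det (fun j => f j) = 0.
Proof.
move=> kk' Pupd; rewrite big_mkcond.
have [M0|M0] := posnP M.
  by apply: big1 => f _; have := leq_trans (leq_ltn_trans (leq0n _) (ltn_ord (f k))) (eq_leq M0).
rewrite (big_upd k' (Ordinal M0)) big1 // => f _.
under eq_bigr => m _ do rewrite Pupd.
have [Pf|] := boolP (P f); last by move=> _; rewrite big1.
have kNk' : k == k' = false by rewrite -val_eqE /= kk' ltn_eqF.
(* If [f k < lam k], row [k] has weight 0. Otherwise every [m > f k] exceeds [lam k], where the
   weight of row [k'] is geometric of ratio [g]. *)
have [fk|fk] := ltnP (f k) (lam k).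
  apply: big1 => m _; rewrite ffunE kNk'; case: ifP => // _.
  by rewrite /W (bigD1 k) //= ffunE kNk' /row_weight fk !mul0r.
(* The part of the weight independent of [m]: the full weight is [c * g ^+ (m - (f k).+1)]. The
   cofactors along row [k'] do not depend on [m] either. *)
pose c := (\prod_(j < n | j != k') row_weight g u w lam j (f j))
  * (g + u) * g ^+ (f k - lam k) * w ^+ (lam k - lam k').
pose cf i := cofactor (\matrix_(j, i) (y i ^+ f j * q i j)) k' i.
transitivity (c * \sum_(m < M | (f k < m)%N) \sum_i
    g ^+ (m - (f k).+1) * (y i ^+ m * q i k') * cf i).
  rewrite mulr_sumr [RHS]big_mkcond; apply: eq_bigr => m _ /=.
  rewrite !ffunE kNk' eqxx; case: ifP => // fm.
  have -> : W (fun j => upd k' m f j) = c * g ^+ (m - (f k).+1).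
    rewrite /W (bigD1 k') //= ffunE eqxx /row_weight kk' /=.
    have l1 := lam_decr k.
    have l2 : (lam k < m)%N := leq_ltn_trans fk fm.
    have -> : (m < lam k.+1)%N = false by lia.
    have -> : (m == lam k.+1 :> nat) = false by lia.
    have e : (m - (lam k).+1 = (f k - lam k) + (m - (f k).+1))%N.
      by move: fk fm; move: (nat_of_ord (f k)) => a; lia.
    rewrite l2 /c kk' e.
    rewrite exprD.
    under eq_bigr => j jk do rewrite ffunE (negPf jk).
    by rewrite /row_weight; ring.
  rewrite -mulrA; congr (_ * _); rewrite /Det (expand_det_row _ k') mulr_sumr.
  apply: eq_bigr => i _; rewrite !mxE ffunE eqxx [LHS]mulrA; congr (_ * _).
  rewrite /cf /cofactor; congr (_ * \det _); apply/matrixP => r s.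
  by rewrite !mxE ffunE eq_sym (negPf (neq_lift _ _)).
rewrite exchange_big /=.
suff -> : \sum_i \sum_(m < M | (f k < m)%N)
    g ^+ (m - (f k).+1) * (y i ^+ m * q i k') * cf i = 0 by rewrite mulr0.
(* By [geom_q], summing row [k'] over [m > f k] gives row [k], so this determinant has two equal
   rows. *)
transitivity (\det (\matrix_(j, i) (y i ^+ f (if j == k' then k else j)
   * q i (if j == k' then k else j)))); last first.
  apply: (@determinant_alternate _ _ _ k k'); first by rewrite kNk'.
  by move=> i; rewrite !mxE kNk' eqxx.
rewrite (expand_det_row _ k'); apply: eq_bigr => i _; rewrite !mxE eqxx.
rewrite -mulr_suml; congr (_ * _); last first.
  rewrite /cf /cofactor; congr (_ * \det _); apply/matrixP => r s.
  by rewrite !mxE eq_sym (negPf (neq_lift _ _)).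
rewrite kk' -geom_q -?kk' // geom_cond mulr_suml.
by apply: eq_bigr => m _; rewrite mulrA.
Qed.

Let decr_upto p (f : {ffun 'I_n -> 'I_M}) : bool :=
  [forall j : 'I_n, forall k : 'I_n,
     (k == j.+1 :> nat) && (k < p)%N ==> (f k <= f j)%N].

(** Induction on [p]: the violations at the pair [(p.-1, p)] cancel because [decr_upto p] only
    constrains rows before [p], hence is insensitive to the row being summed over. *)
Let sum_decr_upto p :
  \sum_(f : {ffun 'I_n -> 'I_M}) W (fun j => f j) * Det (fun j => f j) =
  \sum_(f : {ffun 'I_n -> 'I_M} | decr_upto p f) W (fun j => f j) * Det (fun j => f j).
Proof.
elim: p => [|p ->].
  apply: eq_bigl => f; apply/esym/forallP => j; apply/forallP => k.
  by rewrite ltn0 andbF.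
have [pn|np] := boolP ((0 < p)%N && (p < n)%N); last first.
  apply: eq_bigl => f; apply: eq_forallb => j; apply: eq_forallb => k.
  congr (_ ==> _); case: eqP => //= kj; have := ltn_ord k.
  by move: np; rewrite kj; lia.
case/andP: pn => p0 pn; pose k' := Ordinal pn.
have kn : (p.-1 < n)%N by lia.
pose k := Ordinal kn; have kk' : k' = k.+1 :> nat by rewrite /= prednK.
rewrite (bigID (fun f : {ffun 'I_n -> 'I_M} => (f k < f k')%N)) /=.
rewrite violation_sum // ?add0r => [|f m].
  apply: eq_bigl => f; rewrite -leqNgt; apply/andP/forallP => [[/forallP h fk] i|h].
    apply/forallP => j; apply/implyP => /andP[/eqP ji]; rewrite ltnS leq_eqVlt.
    case/orP => [/eqP jp|jp].
      have -> : j = k' by apply: val_inj.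
      have -> : i = k by apply: val_inj; rewrite /= -jp ji.
      exact: fk.
    by have /forallP/(_ j) := h i; rewrite ji eqxx -ji jp.
  split.
    apply/forallP => i; apply/forallP => j; apply/implyP => /andP[ij jp].
    by have /forallP/(_ j) := h i; rewrite ij ltnW.
  by have /forallP/(_ k') := h k; rewrite kk' eqxx -kk' ltnSn.
apply: eq_forallb => i; apply: eq_forallb => j; case: andP => //= -[/eqP ij jp].
by rewrite !ffunE -!val_eqE /= !ltn_eqF //; lia.
Qed.

(** Since [y i ^+ M = 0], a row of length at least [M] makes the determinant vanish, so the sum over
    lengths below [M] loses nothing. *)
Lemma det_pieri : (\prod_i (1 + u * y i)) * \det (\matrix_(i, j) (y i ^+ lam j * q i j)) =
  (\prod_i (1 - w * y i)) * \sum_(f : {ffun 'I_n -> 'I_M} | decreasing (fun j => f j))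
    (\prod_(j < n) row_weight g u w lam j (f j)) *
    \det (\matrix_(i, j) (y i ^+ f j * q i j)).
Proof.
have DetE (f : 'I_n -> nat) : \det (\matrix_(i, j) (y i ^+ f j * q i j)) = Det f.
  by rewrite /Det -det_tr; congr (\det _); apply/matrixP => i j; rewrite !mxE.
rewrite DetE det_Fcol det_Fcol_expand (sum_decr_upto n); congr (_ * _).
apply: eq_big => [f|f _]; last by rewrite DetE.
by apply: eq_forallb => j; apply: eq_forallb => k; rewrite ltn_ord andbT.
Qed.

End Pieri.

(** * Row-by-row form of the exponents of the weight *)

Section SkewStatistics.
Variables mu lam : intpart.
Hypothesis lam_mu : included lam mu.

Let rl := rlen mu lam.
Let ov := ovl mu lam.
Let ol j : (ov j <= rl j)%N. Proof. exact: ovl_le. Qed.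

(** A nonempty row either starts a component or overlaps the preceding row. This and the next two
    splittings write the exponents of the weight as sums over rows, so that the weight factors. *)
Lemma nrows_split n : (size mu <= n)%N ->
  nrows mu lam = (ncomps mu lam + \sum_(j < n) (0 < ov j))%N.
Proof.
move=> sn; rewrite (nrowsE lam_mu sn) (ncompsE lam_mu sn) -big_split /=.
by apply: eq_bigr => j _; have := ol j; rewrite /rl /ov; case: ovl; case: rlen.
Qed.

Lemma nboxes_split n : (size mu <= n)%N ->
  nboxes mu lam = (ncols mu lam + (\sum_(j < n) (0 < ov j) + \sum_(j < n) (ov j).-1))%N.
Proof.
move=> sn; rewrite (nboxesE lam sn) (ncolsE lam_mu sn) -!big_split /=.
by apply: eq_bigr => j _; have := ol j; rewrite /rl /ov; lia.
Qed.

(** The contribution of row [j] to columns minus components: the columns whose top box is in row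
    [j], less one if the row starts a component. *)
Let inner j := (if (0 < ov j)%N then rl j - ov j else (rl j).-1)%N.

Lemma ncols_split n : (size mu <= n)%N ->
  ncols mu lam = (ncomps mu lam + \sum_(j < n) inner j)%N.
Proof.
move=> sn; rewrite (ncolsE lam_mu sn) (ncompsE lam_mu sn) -!big_split /=.
apply: eq_bigr => j _; rewrite /inner; have := ol j; rewrite /rl /ov.
by case: ovl; case: rlen => //=; lia.
Qed.

Lemma ncomps_le_nrows : (ncomps mu lam <= nrows mu lam)%N.
Proof. by rewrite (nrows_split (leqnn _)) leq_addr. Qed.

Lemma ncomps_le_ncols : (ncomps mu lam <= ncols mu lam)%N.
Proof. by rewrite (ncols_split (leqnn _)) leq_addr. Qed.

(** This makes [ninner] nonnegative, so its natural-number version by truncated subtraction is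
    exact. *)
Lemma nrows_ncols_le :
  (ncols mu lam + nrows mu lam <= nboxes mu lam + ncomps mu lam)%N.
Proof. by rewrite (nboxes_split (leqnn _)) (nrows_split (leqnn _)); lia. Qed.

Lemma ncols_le_nboxes : (ncols mu lam <= nboxes mu lam)%N.
Proof. by rewrite (nboxes_split (leqnn _)) leq_addr. Qed.

(** No row overlaps the preceding one exactly when every nonempty row starts a component. *)
Lemma horizontal_strip_ncomps :
  horizontal_strip mu lam = (nrows mu lam == ncomps mu lam).
Proof.
rewrite (horizontal_stripE lam_mu (leqnn _)) (nrows_split (leqnn _)).
rewrite -[X in _ = (_ == X)]addn0 eqn_add2l !sum_nat_eq0.
by apply: eq_forallb => j; rewrite /ov; case: ovl.
Qed.

Lemma horizontal_strip_nboxes : horizontal_strip mu lam ->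
  nboxes mu lam = ncols mu lam.
Proof.
rewrite (horizontal_stripE lam_mu (leqnn _)) sum_nat_eq0 => /forallP h.
rewrite (nboxes_split (leqnn _)) !big1 ?addn0 // => j _; rewrite /ov.
  by rewrite (eqP (implyP (h j) _)).
by rewrite (eqP (implyP (h j) _)).
Qed.

Lemma vertical_strip_ncomps :
  vertical_strip mu lam = (ncols mu lam == ncomps mu lam).
Proof.
rewrite (vertical_stripE lam_mu (leqnn _)) (ncols_split (leqnn _)).
rewrite -[X in _ = (_ == X)]addn0 eqn_add2l !sum_nat_eq0.
apply/forallP/forallP => /= h j; apply/eqP.
  have /eqP := h j; rewrite /inner; have := ol j; rewrite -/(rl _).
  by case: ifP; lia.
(* Row lengths are bounded from the top down: with [inner] zero, an overlapping row is as long as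
   its overlap, which is at most the length of the preceding row. *)
suff H i : (i < size mu)%N -> (rl i <= 1)%N.
  by have := H j (ltn_ord j); rewrite -/(rl _); lia.
elim: i => [|i IH] ni; have /eqP := h (Ordinal ni); rewrite /inner /=.
  by rewrite /ov /=; lia.
have := IH (ltnW ni); rewrite /rl /rlen /ov /=.
by have := part_leq mu (leqnSn i); case: ifP; lia.
Qed.

Lemma vertical_strip_nboxes : vertical_strip mu lam ->
  nboxes mu lam = nrows mu lam.
Proof.
rewrite (vertical_stripE lam_mu (leqnn _)) sum_nat_eq0 => /forallP h.
rewrite (nboxesE lam (leqnn _)) (nrowsE lam_mu (leqnn _)); apply: eq_bigr => j _.
by have := eqP (implyP (h j) isT); case: rlen => [|[]].
Qed.

Lemma nboxes_eq0 : (nboxes mu lam == 0)%N = (mu == lam).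
Proof.
apply/eqP/eqP => [h|->]; last first.
  by rewrite (nboxesE lam (leqnn _)) big1 // => j _; rewrite /rlen subnn.
apply/intpart_eqP => j; apply/eqP.
have lm := includedP _ _ lam_mu j; rewrite eqn_leq lm andbT.
have [js|sj] := ltnP j (size mu); last by rewrite part_default.
move/eqP: h; rewrite (nboxesE lam (leqnn _)) sum_nat_eq0 => /forallP h.
by have /= := eqP (implyP (h (Ordinal js)) isT); rewrite /rlen => /eqP; rewrite subn_eq0.
Qed.

(** An empty row contributes 1, an overlapping row [(g + u) * g ^+ (ov j).-1 * w ^+ (rl j - ov j)],
    and a row starting a component [(w + u) * w ^+ (rl j).-1]. *)
Lemma row_weight_prod (A : comNzRingType) (g u w : A) n : (size mu <= n)%N ->
  \prod_(j < n) row_weight g u w (part lam) j (part mu j) =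
  (g + u) ^+ (nrows mu lam - ncomps mu lam) *
  g ^+ (nboxes mu lam + ncomps mu lam - (ncols mu lam + nrows mu lam)) *
  (w + u) ^+ ncomps mu lam * w ^+ (ncols mu lam - ncomps mu lam).
Proof.
move=> sn; have er := nrows_split sn; have eb := nboxes_split sn.
have ec := ncols_split sn.
have -> : (nrows mu lam - ncomps mu lam = \sum_(j < n) (0 < ov j))%N by lia.
have -> : (nboxes mu lam + ncomps mu lam - (ncols mu lam + nrows mu lam)
  = \sum_(j < n) (ov j).-1)%N by lia.
have -> : (ncols mu lam - ncomps mu lam = \sum_(j < n) inner j)%N by lia.
rewrite (ncompsE lam_mu sn) !expr_sum -!big_split; apply: eq_bigr => j _ /=.
have lm := includedP _ _ lam_mu j; have := ol j.
rewrite /row_weight /inner -/(rl _) -/(ov _) ltnNge lm /=.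
have [e|ne] := eqVneq (part mu j) (part lam j).
  have -> : rl j = 0%N by rewrite /rl /rlen e subnn.
  by rewrite leqn0 => /eqP ->; rewrite !expr0 !mulr1.
have r0 : (0 < rl j)%N by rewrite /rl /rlen; lia.
rewrite r0; case: (nat_of_ord j) lm ne r0 => [|i] lm ne r0 _ /=.
  by rewrite !expr0 !mul1r expr1 /rl /rlen subnS.
have -> : (part lam i < part mu i.+1)%N = (0 < ov i.+1)%N by rewrite /ov /=; lia.
have l1 := part_leq lam (leqnSn i).
case: ifP => o.
  rewrite ?o; have -> : (ov i.+1 == 0)%N = false by rewrite eqn0Ngt o.
  rewrite !expr0 expr1 mulr1; congr (_ * _ ^+ _ * _ ^+ _).
    by rewrite /ov /=; lia.
  by move: o; rewrite /rl /rlen /ov /=; lia.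
have o0 : (part mu i.+1 - part lam i = 0)%N by move: o; rewrite /ov /=; lia.
rewrite /ov /= o0 !expr0 !mul1r expr1; congr (_ * _ ^+ _).
by rewrite /rl /rlen subnS.
Qed.

End SkewStatistics.

(** * Power series and Grothendieck polynomials in finitely many variables *)

Lemma size_msetD (k l : monom) : size (k `+` l)%mset = (size k + size l)%N.
Proof.
rewrite -size_cat; apply: perm_size; apply/allP => x _ /=.
by rewrite count_cat !count_mem_mset msetE2.
Qed.

Lemma size_divisor (k m : monom) : (k `<=` m)%mset ->
  size m = (size k + size (m `\` k)%mset)%N.
Proof. by move=> km; rewrite -size_msetD msetBDKC. Qed.

Lemma size_msetB1 (m : monom) i : i \in m ->
  size m = (size (m `\ i)%mset).+1.
Proof. by rewrite -msub1set => /size_divisor ->; rewrite enum_msetn. Qed.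

Lemma nvars_leq (m : monom) n : (nvars m <= n)%N = all (fun i => i < n)%N m.
Proof.
by apply/bigmax_leqP_seq/allP => h i im; [apply: h|move=> _; apply: h].
Qed.

Lemma nvars_divisor (k m : monom) n : (k `<=` m)%mset ->
  (nvars m <= n)%N = (nvars k <= n)%N && (nvars (m `\` k)%mset <= n)%N.
Proof.
move=> km; rewrite !nvars_leq -all_cat; apply: eq_all_r => i.
by rewrite mem_cat -{1}(msetBDKC km) in_msetD.
Qed.

Section Fps.
Variable R : comNzRingType.
Implicit Types (f g h : fps R) (m k : monom) (a : R).

Lemma fps_coef_sum (I : Type) (r : seq I) (P : pred I) (F : I -> fps R) m :
  coef (\sum_(i <- r | P i) F i) m = \sum_(i <- r | P i) coef (F i) m.
Proof. exact: (big_morph (fun f => coef f m) (fun _ _ => erefl) erefl). Qed.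

Lemma fps_coefZ a f m : coef (a *: f) m = a * coef f m.
Proof. by []. Qed.

(** The specialization at [x_n = x_(n+1) = ... = 0], kept inside the same ring. *)
Definition restrict n f : fps R :=
  Fps (fun m => if (nvars m <= n)%N then coef f m else 0).

Fact restrict_is_zmod_morphism n : zmod_morphism (restrict n).
Proof.
move=> f g; apply: fpsP => m /=.
by case: ifP => // _; rewrite subr0.
Qed.

Fact restrict_is_monoid_morphism n : monoid_morphism (restrict n).
Proof.
split=> [|f g]; apply: fpsP => m; rewrite [LHS]/=.
  case: ifP => // /negbT; rewrite nvars_leq => /allPn[i im _] /=.
  by case: eqP im => // ->; rewrite in_mset0.
rewrite [coef (f * g) m]coef_fpsM [RHS]coef_fpsM; case: ifP => mn.
  apply: eq_big_seq => k; rewrite in_divisors_of => km /=.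
  by move: mn; rewrite (nvars_divisor _ km) => /andP[-> ->].
rewrite big_seq big1 // => k; rewrite in_divisors_of => km /=.
move: mn; rewrite (nvars_divisor _ km).
by do 2![case: ifP => _] => //; rewrite ?mul0r ?mulr0.
Qed.

HB.instance Definition _ n := GRing.isZmodMorphism.Build (fps R) (fps R)
  (restrict n) (restrict_is_zmod_morphism n).
HB.instance Definition _ n := GRing.isMonoidMorphism.Build (fps R) (fps R)
  (restrict n) (restrict_is_monoid_morphism n).

Lemma restrictZ n a f : restrict n (a *: f) = a *: restrict n f.
Proof. by apply: fpsP => m /=; case: ifP; rewrite ?mulr0. Qed.

Lemma restrict_fvar n i : restrict n (fvar i) = if (i < n)%N then fvar i else 0.
Proof.
apply: fpsP => m /=; rewrite nvars_leq coef_fvar.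
have [->|ne] := eqVneq m [mset i]%mset; last first.
  by case: ifP => _; case: ifP => _ //=; rewrite coef_fvar (negPf ne).
by rewrite enum_msetn /= andbT; case: ifP => _ //=; rewrite coef_fvar eqxx.
Qed.

Lemma coef_restrict n f m : (nvars m <= n)%N -> coef (restrict n f) m = coef f m.
Proof. by move=> h /=; rewrite h. Qed.

Definition order_ge D f := forall m, (size m < D)%N -> coef f m = 0.

Lemma order_geD D f g : order_ge D f -> order_ge D g -> order_ge D (f + g).
Proof. by move=> fD gD m mD; rewrite /= fD // gD // addr0. Qed.

Lemma order_geM D E f g : order_ge D f -> order_ge E g -> order_ge (D + E) (f * g).
Proof.
move=> fD gE m mDE; rewrite [LHS]coef_fpsM big_seq big1 // => k.
rewrite in_divisors_of => km; have sz := size_divisor km.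
have [kD|Dk] := ltnP (size (k : monom)) D; first by rewrite fD ?mul0r.
by rewrite gE ?mulr0 //; lia.
Qed.

Lemma order_ge0 f : order_ge 0 f. Proof. by []. Qed.

Lemma order_geMr D f g : order_ge D f -> order_ge D (g * f).
Proof. by move=> fD; have := order_geM (@order_ge0 g) fD. Qed.

Lemma order_geX D f : order_ge 1 f -> order_ge D (f ^+ D).
Proof.
move=> f1; elim: D => [|D IH]; first exact: order_ge0.
by rewrite exprS; apply: (order_geM f1 IH).
Qed.

Lemma order_ge_fvar i : order_ge 1 (fvar i : fps R).
Proof.
move=> m; rewrite ltnS leqn0 size_mset_eq0 => /eqP ->; rewrite coef_fvar.
case: eqP => // /msetP /(_ i).
by rewrite mset0E msetnxx.
Qed.

(** The shift to [D.+1] makes the ideal proper even for [D = 0], so that the quotient is a nonzero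
    ring. *)
Definition order_ideal D : {pred fps R} := fun f => `[< order_ge D.+1 f >].

Fact order_ideal_closed D : idealr_closed (order_ideal D).
Proof.
split=> [||c f g].
- by apply/asboolP => m.
- apply/negP => /asboolP /(_ mset0) /=.
  by rewrite size_mset0 eqxx => /(_ isT)/eqP; rewrite oner_eq0.
by move=> /asboolP fD /asboolP gD; apply/asboolP/order_geD => //; apply: order_geMr.
Qed.

HB.instance Definition _ D :=
  isIdealr.Build (fps R) (order_ideal D) (order_ideal_closed D).

(** In this quotient every series of order at least 1 is nilpotent, as [det_pieri] requires. Only
    the kernel of the projection matters later, so the construction stays behind an existential. *)
Lemma truncated_quotient D :
  exists (Q : comNzRingType) (pr : {rmorphism fps R -> Q}),
  forall f g, pr f = pr g <-> order_ge D.+1 (f - g).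
Proof.
exists {ideal_quot (order_ideal D)}, \pi_({ideal_quot (order_ideal D)})%qT => f g.
split=> [/eqP|h]; first by rewrite -Quotient.idealrBE => /asboolP.
by apply/eqP; rewrite -Quotient.idealrBE; apply/asboolP.
Qed.

(** Multiplication by [g] raises the order by at most [e]: a quantitative regularity that can be
    used modulo high order. *)
Definition order_regular e g :=
  forall D f, order_ge (D + e) (g * f) -> order_ge D f.

Lemma order_regularM d e g h :
  order_regular d g -> order_regular e h -> order_regular (d + e) (g * h).
Proof.
move=> gd he D f; rewrite -mulrA addnC -addnA addnC => /gd.
by rewrite addnC; apply: he.
Qed.

(* The truncation of [f] in degrees [< D] is killed by [x_i - x_j]. *)
Lemma order_regular_fvarB (i j : nat) : i != j ->
  order_regular 1 (fvar i - fvar j : fps R).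
Proof.
move=> ij D f fD; pose f' : fps R := Fps (fun m => if (size m < D)%N then coef f m else 0).
have f'0 : f' = 0.
  apply: (fvarB_lreg ij); rewrite mulr0 mulrBl; apply: fpsP => m.
  have [mD|Dm] := ltnP (size m) (D + 1).
    have := fD m mD; rewrite mulrBl /= !coef_fvarM.
    have H x : x \in m -> (size (m `\ x)%mset < D)%N.
      by move=> xm; move: mD; rewrite addn1 (size_msetB1 xm) ltnS.
    by case: ifP => [/H h1|_]; case: ifP => [/H h2|_]; rewrite /= ?h1 ?h2.
  rewrite /= !coef_fvarM.
  have H x : x \in m -> (size (m `\ x)%mset < D)%N = false.
    by move=> xm; move: Dm; rewrite addn1 (size_msetB1 xm) ltnS leqNgt => /negPf.
  by case: ifP => [/H h1|_]; case: ifP => [/H h2|_]; rewrite /= ?h1 ?h2 subr0.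
move=> m mD; have := congr1 (fun h => coef h m) f'0.
by rewrite /= mD.
Qed.

Lemma order_regular_vdm n : exists e, order_regular e (vdm R n).
Proof.
pose ok g := exists e, order_regular e g.
have ok1 : ok 1 by exists 0%N => D f; rewrite addn0 mul1r.
have okM g h : ok g -> ok h -> ok (g * h).
  by move=> [d gd] [e he]; exists (d + e)%N; apply: order_regularM.
apply: (big_ind ok) => // i _; apply: (big_ind ok) => // j ij.
by exists 1%N; apply: order_regular_fvarB; rewrite neq_ltn ij.
Qed.

Lemma fvar_lreg i : GRing.lreg (fvar i : fps R).
Proof.
move=> f g e; apply: fpsP => m.
have := congr1 (fun h => coef h (i +` m)%mset) e.
by rewrite /= !coef_fvarM mset1D1 msetD1K.
Qed.

End Fps.

(** * Vandermonde determinants and divisibility by them *)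

Section Vandermonde.
Variables (A : comNzRingType) (x : nat -> A).

Definition vandermonde n : A :=
  \prod_(i < n) \prod_(j < n | (i < j)%N) (x i - x j).

(** Up to sign, the [k]-th Newton interpolation polynomial of the nodes [x], evaluated at [x i]. It
    vanishes for [i < k], which makes its matrix triangular. *)
Let newton (i k : nat) : A := \prod_(l < k) (x l - x i).

Let newton0 (i k : nat) : (i < k)%N -> newton i k = 0.
Proof. by move=> ik; rewrite /newton (bigD1 (Ordinal ik)) //= subrr mul0r. Qed.

Let newtonS (i k : nat) : newton i k.+1 = newton i k * (x k - x i).
Proof. exact: big_ord_recr. Qed.

Let newton_expand n (p : {poly A}) : exists D : nat -> A,
  forall i, (i < n)%N -> p.[x i] = \sum_(k < n) newton i k * D k.
Proof.
elim/poly_ind: p => [|p c [D IH]].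
  exists (fun=> 0) => i _; rewrite horner0 big1 // => k _; exact: mulr0.
(* Multiplication by the variable acts on the Newton basis by [newton i k * x i = x k * newton i k -
   newton i k.+1]. *)
exists (fun k => (if k is k'.+1 then - D k' else c) + x k * D k) => i ni.
rewrite !hornerE IH // mulr_suml.
under [RHS]eq_bigr do rewrite mulrDr.
rewrite big_split /=; case: n ni {IH} => // n ni.
rewrite [X in _ = X + _]big_ord_recl /=.
rewrite {2}/newton big_ord0 mul1r -addrA [RHS]addrC; congr (_ + _).
have -> : \sum_(k < n) newton i (lift ord0 k) * - D k =
    \sum_(k < n.+1) newton i k.+1 * - D k.
  by rewrite big_ord_recr /= [newton i n.+1]newton0 ?mul0r ?addr0 //; lia.
rewrite -big_split; apply: eq_bigr => k _ /=.
by rewrite newtonS; ring.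
Qed.

Lemma det_newton n : \det (\matrix_(i < n, k < n) newton i k) = vandermonde n.
Proof.
rewrite det_trig; last first.
  by apply/is_trig_mxP => i k ik; rewrite mxE newton0.
rewrite /vandermonde (exchange_big_dep xpredT) //=; apply: eq_bigr => i _.
by rewrite mxE /newton (big_ord_widen n (fun l => x l - x i)) // ltnW.
Qed.

(** Expanding each [p j] in the Newton basis factors the matrix through the Newton matrix; this
    works over any commutative ring. *)
Lemma det_horner n (p : 'I_n -> {poly A}) :
  exists Q, \det (\matrix_(i < n, j < n) (p j).[x i]) = Q * vandermonde n.
Proof.
have /choice[D HD] : forall j, exists D : nat -> A,
  forall i, (i < n)%N -> (p j).[x i] = \sum_(k < n) newton i k * D k.
  by move=> j; apply: newton_expand.
exists (\det (\matrix_(k < n, j < n) D j k)).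
rewrite mulrC -det_newton -det_mulmx; congr (\det _).
apply/matrixP => i j; rewrite !mxE HD //.
by apply: eq_bigr => k _; rewrite !mxE.
Qed.

Lemma det_vandermonde n :
  \det (\matrix_(i < n, j < n) x i ^+ (n - j.+1)) = vandermonde n.
Proof.
(* Rows and columns are both reversed, so the two signs cancel. *)
pose s : 'S_n := perm (@rev_ord_inj n).
pose v : 'rV[A]_n := \row_j x (rev_ord j).
have -> : (\matrix_(i < n, j < n) x i ^+ (n - j.+1)) =
    row_perm s (col_perm s (Vandermonde n v)^T).
  by apply/matrixP => i j; rewrite !mxE !permE rev_ordK.
rewrite row_permE col_permE !det_mulmx !det_perm det_tr odd_permV.
rewrite [X in _ * X]mulrC mulrA -signr_addb addbb mul1r det_Vandermonde.
rewrite (reindex_inj rev_ord_inj) /vandermonde [RHS](exchange_big_dep xpredT) //=.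
apply: eq_bigr => i _; rewrite (reindex_inj rev_ord_inj) /=.
apply: eq_big => [j|j _]; last by rewrite !mxE !rev_ordK.
by have := ltn_ord i; have := ltn_ord j; lia.
Qed.

(** The binomial expansion of column [j] involves the powers [n - k.+1] with [k <= j], so the change
    of columns [T] is unitriangular. *)
Lemma det_vandermonde_shift b n :
  \det (\matrix_(i < n, j < n) (x i ^+ (n - j.+1) * (1 + b * x i) ^+ j))
  = vandermonde n.
Proof.
pose T : 'M[A]_n := \matrix_(k < n, j < n) (b ^+ (j - k) *+ 'C(j, k)).
have dT : \det T = 1.
  rewrite -det_tr det_trig; last first.
    by apply/is_trig_mxP => i k ik; rewrite !mxE bin_small.
  by rewrite big1 // => i _; rewrite !mxE subnn binn.
transitivity (\det (\matrix_(i < n, j < n) x i ^+ (n - j.+1)) * \det T); last first.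
  by rewrite dT mulr1 det_vandermonde.
rewrite -det_mulmx; congr (\det _).
apply/matrixP => i j; rewrite !mxE [1 + _]addrC exprDn mulr_sumr.
rewrite (big_ord_widen n (fun k => x i ^+ (n - j.+1) *
   ((b * x i) ^+ (j - k) * 1 ^+ k *+ 'C(j, k)))) // big_mkcond /=.
apply: eq_bigr => k _; rewrite !mxE; case: ltnP => kj; last first.
  by rewrite bin_small // mulr0n mulr0.
rewrite expr1n mulr1 !mulrnAr exprMn mulrCA -exprD mulrC.
by congr (_ ^+ _ * _ *+ _); have := ltn_ord j; lia.
Qed.

End Vandermonde.

(** * Exact division by the Vandermonde product and stability of [Gfin] *)

Section Grothendieck.
Variables (R : comNzRingType) (a b : R).
Implicit Types (lam mu : intpart).

Let x (i : nat) : fps R := fvar i.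
Let den i : fps R := 1 - a *: x i.

Let den_unit i : den i \is a GRing.unit. Proof. exact: unit_fps1BZ. Qed.

Lemma vdmE n : vdm R n = vandermonde x n. Proof. by []. Qed.

(** Multiplying row [i] by the unit [den i ^+ part lam 0] clears all denominators and leaves
    polynomials evaluated at [x i], to which [det_horner] applies. *)
Lemma Gfin_vdm n lam : Gfin a b n lam * vdm R n = Gnum a b n lam.
Proof.
pose p (j : 'I_n) : {poly fps R} := 'X^(part lam j + (n - j.+1)) *
  (1 + (b%:A)%:P * 'X) ^+ j * (1 - (a%:A)%:P * 'X) ^+ (part lam 0 - part lam j).
have [Q HQ] := det_horner x p.
pose c := \prod_(i < n) den i ^+ part lam 0.
have cU : c \is a GRing.unit.
  by apply: rpred_prod => i _; rewrite unitrX.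
suff e : Gnum a b n lam = Q / c * vdm R n.
  by rewrite /Gfin (exquoE (q := Q / c)) //; apply: vdm_lreg.
apply: (mulrI cU); rewrite [RHS]mulrA [c * (Q / c)]mulrC divrK // vdmE -HQ.
have -> : c = \det (diag_mx (\row_i den (nat_of_ord (i : 'I_n)) ^+ part lam 0)).
  by rewrite det_diag; apply: eq_bigr => i _; rewrite mxE.
rewrite -det_mulmx; congr (\det _); apply/matrixP => i j.
rewrite mul_diag_mx !mxE /p !hornerE !mulr_algl /=.
have lj : (part lam j <= part lam 0)%N by apply: part_leq.
rewrite -{1}(subnK lj) exprD; set d := den i; set X := x i ^+ _.
transitivity (X * (1 + b *: x i) ^+ j * d ^+ (part lam 0 - part lam j) *
  (d ^+ part lam j / d ^+ part lam j)); last first.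
  by rewrite divrr ?mulr1 //; apply/unitrX/den_unit.
by rewrite /X /d /den /x; set r := _^-1; ring.
Qed.

Lemma Gfin_uniq n lam f : f * vdm R n = Gnum a b n lam -> Gfin a b n lam = f.
Proof. by move=> e; apply: exquoE => //; apply: vdm_lreg. Qed.

Definition xprod n : fps R := \prod_(i < n) x i.

(** The factors [x i - x n] become [x i]. The numerator acquires the same product, so it cancels in
    the quotient. *)
Lemma restrict_vdm n : restrict n (vdm R n.+1) = vdm R n * xprod n.
Proof.
rewrite rmorph_prod big_ord_recr /= rmorph_prod [X in _ * X]big1 ?mulr1; last first.
  by move=> j; have := ltn_ord j; lia.
rewrite /xprod -big_split; apply: eq_bigr => i _ /=.
rewrite rmorph_prod big_mkcond big_ord_recr /= ltn_ord rmorphB /=.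
rewrite !restrict_fvar ltnn ltn_ord subr0; congr (_ * _).
rewrite -big_mkcond; apply: eq_bigr => j _ /=.
by rewrite rmorphB /= !restrict_fvar !ltn_ord.
Qed.

Lemma xprod_lreg n : GRing.lreg (xprod n).
Proof.
by apply: (big_ind (@GRing.lreg _)) => [|f g|i _];
  [exact: lreg1|exact: lregM|exact: fvar_lreg].
Qed.

Lemma restrict_entry n i (l e j : nat) :
  restrict n (x i ^+ e * (1 + b *: x i) ^+ j / den i ^+ l) =
  if (i < n)%N then x i ^+ e * (1 + b *: x i) ^+ j / den i ^+ l else (e == 0)%N%:R.
Proof.
have rx : restrict n (x i) = if (i < n)%N then x i else 0 by apply: restrict_fvar.
rewrite rmorphM /= rmorphV ?unitrX //= rmorphM !rmorphXn rmorphD rmorphB !rmorph1 /=.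
rewrite !restrictZ rx; case: ifP => // _.
by rewrite !scaler0 addr0 subr0 !expr1n mulr1 divr1 expr0n.
Qed.

(** At [x n = 0] the last row becomes the last unit vector, because [part lam n = 0]; each other row
    releases one factor [x i]. *)
Lemma restrict_Gnum n lam : (size lam <= n)%N ->
  restrict n (Gnum a b n.+1 lam) = Gnum a b n lam * xprod n.
Proof.
move=> ln; rewrite /Gnum -det_map_mx (expand_det_row _ ord_max) big_ord_recr /=.
rewrite big1 ?add0r => [|j _]; last first.
  rewrite !mxE restrict_entry ltnn /=; case: eqP; last by rewrite mul0r.
  by have := ltn_ord j; lia.
rewrite !mxE restrict_entry ltnn /= part_default // subnn mul1r.
rewrite /cofactor -signr_odd oddD addbb mul1r.
have -> : xprod n = \det (diag_mx (\row_(i < n) x i)).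
  by rewrite det_diag; apply: eq_bigr => i _; rewrite mxE.
rewrite mulrC -det_mulmx; congr (\det _); apply/matrixP => i j.
rewrite mul_diag_mx !mxE restrict_entry !lift_max ltn_ord !mulrA -exprS.
by congr (_ ^+ _ * _ / _); rewrite -addnS -subSn //; exact: (ltn_ord (j : 'I_n)).
Qed.

Lemma restrict_Gfin n lam : (size lam <= n)%N ->
  restrict n (Gfin a b n.+1 lam) = Gfin a b n lam.
Proof.
move=> ln; apply/esym/Gfin_uniq/(@xprod_lreg n).
by rewrite mulrCA [xprod n * vdm _ _]mulrC -restrict_vdm -rmorphM /= Gfin_vdm restrict_Gnum // mulrC.
Qed.

(** Here all parts with index at most [n] are positive, so the last row of the numerator vanishes at
    [x n = 0]. *)
Lemma restrict_Gfin_size lam n : size lam = n.+1 ->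
  restrict n (Gfin a b n.+1 lam) = 0.
Proof.
move=> sl; apply: (lregM (@vdm_lreg R n) (@xprod_lreg n)).
rewrite mulr0 -restrict_vdm mulrC -rmorphM /= Gfin_vdm /Gnum -det_map_mx.
rewrite (expand_det_row _ ord_max) big1 // => j _.
rewrite !mxE /= restrict_entry ltnn /=.
have := @ipart_gt0 lam j; rewrite sl ltn_ord => /(_ isT).
by case: (part lam j) => // p _; rewrite mul0r.
Qed.

Lemma coef_G lam m n : (size lam <= n)%N -> (nvars m <= n)%N ->
  coef (G a b lam) m = coef (Gfin a b n lam) m.
Proof.
move=> ln mn; rewrite /G /=; set k := maxn _ _.
have kn : (k <= n)%N by rewrite geq_max ln mn.
have lk : (size lam <= k)%N by rewrite leq_maxl.
have mk : (nvars m <= k)%N by rewrite leq_maxr.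
rewrite -(subnKC kn); elim: (n - k)%N => [|d IH]; first by rewrite addn0.
rewrite addnS IH -(@restrict_Gfin (k + d)) ?(leq_trans lk) ?leq_addr //.
by rewrite coef_restrict // (leq_trans mk) ?leq_addr.
Qed.

Lemma coef_G_eq0 lam m n : (n < size lam)%N -> (nvars m <= n)%N ->
  coef (G a b lam) m = 0.
Proof.
move=> ln mn; rewrite (coef_G (leqnn _) (leq_trans mn (ltnW ln))).
case E : (size lam) ln => [//|k]; rewrite ltnS => nk.
by rewrite -(coef_restrict _ (leq_trans mn nk)) restrict_Gfin_size.
Qed.

(** The first column is divisible by the powers [x i ^+ part lam 0]. Hence shapes with a long first
    row do not affect low degrees. *)
Lemma Gnum_order n lam M : (M <= part lam 0)%N -> (0 < n)%N ->
  order_ge M (Gnum a b n lam).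
Proof.
case: n => // n Ml _; rewrite /Gnum (expand_det_col _ ord0).
apply: (big_ind (order_ge M)) => [//|f g|i _]; first exact: order_geD.
rewrite !mxE mulrC; apply: order_geMr; rewrite mulrC; apply: order_geMr.
rewrite mulrC; apply: order_geMr; rewrite -{1}(subnK Ml) addnAC exprD.
by apply/order_geMr/order_geX/order_ge_fvar.
Qed.

Lemma Gnum_nil n lam : size lam = 0%N -> Gnum a b n lam = vdm R n.
Proof.
move=> l0; rewrite vdmE -(det_vandermonde_shift x (b%:A)) /Gnum; congr (\det _).
apply/matrixP => i j; rewrite !mxE part_default ?l0 // add0n expr0 divr1.
by rewrite mulr_algl.
Qed.

End Grothendieck.

(** * Complete and elementary symmetric functions *)

Section SortedSeqs.
Variable r : rel nat.
Hypothesis r_trans : transitive r.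

(** Tuples over ['I_n] are recast as sequences of natural numbers so that the index sets for
    different [n] can be compared. *)
Definition sorted_seqs n k : seq (seq nat) :=
  [seq map val (tval t) | t : k.-tuple 'I_n <- enum {: k.-tuple 'I_n}
                            & sorted r (map val (tval t))].

Lemma mem_sorted_seqs n k s : (s \in sorted_seqs n k) =
  [&& size s == k, all (fun i => i < n)%N s & sorted r s].
Proof.
apply/mapP/and3P => [[t]|[/eqP sk sn srt]].
  rewrite mem_filter => /andP[ts _] ->; rewrite size_map size_tuple eqxx ts.
  by split=> //; apply/allP => _ /mapP[i _ ->]; apply: ltn_ord.
have e : map val (pmap (insub : nat -> option 'I_n) s) = s.
  rewrite (pmap_filter (insubK _)); apply/all_filterP/allP => i si /=.
  by rewrite insubT //; apply: (allP sn).
have st : size (pmap (insub : nat -> option 'I_n) s) == k.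
  by rewrite -(size_map val) e sk.
exists (Tuple st); last by rewrite /= e.
by rewrite mem_filter /= e srt mem_enum.
Qed.

Lemma sorted_seqs_uniq n k : uniq (sorted_seqs n k).
Proof.
rewrite map_inj_uniq; first by apply: filter_uniq; apply: enum_uniq.
by move=> s t /(inj_map val_inj)/val_inj.
Qed.

(** The sequences are split by whether their last entry is [n]. The entries allowed before a final
    [n] are those below [n'], which is [n.+1] for [leq] and [n] for [ltn]. *)
Lemma sorted_seqs_rec n n' k :
  (forall i, ((i < n.+1) && r i n)%N = (i < n')%N) ->
  (forall i j, r i j -> j < n -> i < n)%N ->
  perm_eq (sorted_seqs n.+1 k.+1)
    (sorted_seqs n k.+1 ++ [seq rcons s n | s <- sorted_seqs n' k]).
Proof.
move=> rn rlt; apply: uniq_perm; first exact: sorted_seqs_uniq.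
  rewrite cat_uniq !sorted_seqs_uniq map_inj_uniq ?sorted_seqs_uniq ?andbT /=.
    apply/hasPn => _ /mapP[s _ ->]; apply/negP.
    by rewrite mem_sorted_seqs all_rcons ltnn andbF.
  by move=> s t /rcons_inj[].
move=> s; rewrite mem_cat !mem_sorted_seqs.
case/lastP: s => [|s z].
  by apply/esym/negbTE/negP => /= /mapP[s _ /(congr1 size)]; rewrite size_rcons.
rewrite !size_rcons eqSS !all_rcons !(sorted_pairwise r_trans) !pairwise_rcons.
have -> : (rcons s z \in [seq rcons s n | s <- sorted_seqs n' k]) =
    (z == n) && (s \in sorted_seqs n' k).
  apply/mapP/andP => [[t ts /rcons_inj[-> ->]]|[/eqP-> sk]]; first by rewrite eqxx.
  by exists s.
rewrite mem_sorted_seqs (sorted_pairwise r_trans).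
case: (size s == k) => //=; last by rewrite andbF.
case: (pairwise r s); rewrite ?andbF ?andbT //.
have alln' : all (fun i => i < n')%N s = all (fun i => i < n.+1)%N s && all (r^~ n) s.
  by rewrite -all_predI; apply: eq_all => i /=; rewrite rn.
case: (ltngtP z n) => [zn|zn|->].
- rewrite (leqW zn) orbF /=; apply/andP/andP => -[h1 h2]; split=> //.
    by apply/allP => i si; apply: (rlt _ _ (allP h2 _ si)).
  by apply: sub_all h1 => i; apply: leqW.
- by rewrite ltnS leqNgt zn.
by rewrite ltnSn /= alln'.
Qed.

End SortedSeqs.

Section SymFin.
Variable A : comNzRingType.
Implicit Type y : nat -> A.

Definition symfin (r : rel nat) n k y : A :=
  \sum_(t : k.-tuple 'I_n | sorted r (map val t)) \prod_(i <- t) y i.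

Lemma symfinE r n k y :
  symfin r n k y = \sum_(s <- sorted_seqs r n k) \prod_(i <- s) y i.
Proof.
rewrite /sorted_seqs big_map big_filter big_enum_cond /=.
by apply: eq_bigr => t _; rewrite big_map.
Qed.

Lemma symfin0 r n y : symfin r n 0 y = 1.
Proof.
rewrite /symfin (big_pred1 [tuple]) ?big_nil // => t.
by rewrite tuple0 /= eqxx.
Qed.

Lemma symfin_0S r k y : symfin r 0 k.+1 y = 0.
Proof. by apply: big1 => t _; case: (thead t). Qed.

Lemma symfin_rec r n n' k y : transitive r ->
  (forall i, ((i < n.+1) && r i n)%N = (i < n')%N) ->
  (forall i j, r i j -> j < n -> i < n)%N ->
  symfin r n.+1 k.+1 y = symfin r n k.+1 y + y n * symfin r n' k y.
Proof.
move=> rt rn rlt; rewrite !symfinE (perm_big _ (sorted_seqs_rec rt _ rn rlt)).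
rewrite big_cat mulr_sumr; congr (_ + _); rewrite big_map; apply: eq_bigr => s _.
by rewrite big_rcons /= mulrC.
Qed.

Definition hfin := symfin leq.
Definition efin := symfin ltn.

Lemma hfin_rec n k y : hfin n.+1 k.+1 y = hfin n k.+1 y + y n * hfin n.+1 k y.
Proof.
by apply: symfin_rec => [|i|i j]; [exact: leq_trans|rewrite ltnS andbb|lia].
Qed.

Lemma efin_rec n k y : efin n.+1 k.+1 y = efin n k.+1 y + y n * efin n k y.
Proof.
by apply: symfin_rec => [|i|i j]; [exact: ltn_trans|rewrite ltnS; lia|lia].
Qed.

(** The generating function [1 / \prod_i (1 - t y_i)] of the [h_k], stated without power series in
    [t]. For [D = 0] it shows that the product is not a zero divisor. *)
Lemma hfin_gen n y (P : {poly A}) (D : A) k :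
  \prod_(i < n) (1 - 'X * (y i)%:P) * P = D%:P -> P`_k = hfin n k y * D.
Proof.
elim: n P k => [|n IH] P k.
  rewrite big_ord0 mul1r => ->; rewrite coefC.
  by case: k => [|k]; rewrite ?[hfin _ _ _]symfin0 ?[hfin _ _ _]symfin_0S ?mul1r ?mul0r.
rewrite big_ord_recr /= -mulrA => /IH H.
elim: k => [|k IHk].
  have := H 0%N; rewrite mulrBl mul1r -mulrA coefB coefXM subr0.
  by rewrite /hfin !symfin0.
have := H k.+1; rewrite mulrBl mul1r -mulrA coefB coefXM coefCM /= IHk => /eqP.
by rewrite subr_eq => /eqP ->; rewrite hfin_rec mulrDl mulrA.
Qed.

Lemma efin_gen n y k : (\prod_(i < n) (1 + 'X * (y i)%:P))`_k = efin n k y.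
Proof.
elim: n k => [|n IH] k.
  rewrite big_ord0 coef1.
  by case: k => [|k]; rewrite ?[efin _ _ _]symfin0 ?[efin _ _ _]symfin_0S.
rewrite big_ord_recr /= mulrDr mulr1 mulrCA coefD coefXM coefMC IH.
case: k => [|k] /=; first by rewrite addr0 /efin !symfin0.
by rewrite IH efin_rec mulrC.
Qed.

End SymFin.

Lemma rmorph_symfin (A B : comNzRingType) (h : {rmorphism A -> B}) r n k y :
  h (symfin r n k y) = symfin r n k (h \o y).
Proof.
rewrite rmorph_sum; apply: eq_bigr => t _; rewrite rmorph_prod.
exact: eq_bigr.
Qed.

Section SymStable.
Variables (R : comNzRingType) (y : nat -> fps R).
Hypothesis y_restrict : forall n, restrict n (y n) = 0.

(** Passing from [n] to [n.+1] variables adds a multiple of [y n], which [restrict n] kills. *)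
Let stable (F : nat -> nat -> fps R) :
  (forall n, F n 0%N = 1) ->
  (forall n k, exists f, F n.+1 k.+1 = F n k.+1 + y n * f) ->
  forall k m n, (nvars m <= n)%N -> coef (F (nvars m) k) m = coef (F n k) m.
Proof.
move=> F0 FS k m n mn; rewrite -(subnKC mn); elim: (n - nvars m)%N => [|d IH].
  by rewrite addn0.
rewrite addnS IH; case: k IH => [|k] _; first by rewrite !F0.
have [f ->] := FS (nvars m + d)%N k.
have md : (nvars m <= nvars m + d)%N by apply: leq_addr.
rewrite -[RHS](coef_restrict _ md) rmorphD rmorphM /= y_restrict mul0r addr0.
by rewrite md.
Qed.

Lemma coef_hsymf k m n : (nvars m <= n)%N ->
  coef (hsymf k y) m = coef (hfin n k y) m.
Proof.
apply: (stable (F := fun n k => hfin n k y)) => [n'|n' k'].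
  exact: symfin0.
by exists (hfin n'.+1 k' y); apply: hfin_rec.
Qed.

Lemma coef_esymf k m n : (nvars m <= n)%N ->
  coef (esymf k y) m = coef (efin n k y) m.
Proof.
apply: (stable (F := fun n k => efin n k y)) => [n'|n' k'].
  exact: symfin0.
by exists (efin n' k' y); apply: efin_rec.
Qed.

End SymStable.

(** * Summation over partitions *)

Section BoxPartitions.
Variables n M : nat.
Implicit Type f : {ffun 'I_n -> 'I_M.+1}.

Definition decr f := decreasing (fun j => f j).

(** Zero entries are dropped. The default value is taken only for some [f] that are not weakly
    decreasing. *)
Definition intpart_of f : intpart :=
  insubd (one_row 0) [seq m <- [seq nat_of_ord (f j) | j <- enum 'I_n] | 0 < m]%N.

Let nth_filter s j : sorted geq s ->
  nth 0%N [seq m <- s | 0 < m]%N j = nth 0%N s j.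
Proof.
elim: s j => [|m s IH] j //= ms.
case: m ms => [|m] ms; last by case: j => //= j; apply: IH (path_sorted ms).
have s0 : s = nseq (size s) 0%N.
  by elim: s ms {IH} => //= m s IH /andP[]; rewrite leqn0 => /eqP -> /IH <-.
move: (size s) s0 => k ->; rewrite [filter _ _](_ : _ = [::]); last by elim: k.
by case: j => //= j; rewrite nth_nseq if_same.
Qed.

Lemma decrP f : decr f -> sorted geq [seq nat_of_ord (f j) | j <- enum 'I_n].
Proof.
move=> /forallP df; apply/(sortedP 0%N) => i; rewrite size_map size_enum_ord => ni.
have n0 : (i < n)%N by lia.
have nm k : (k < n)%N -> nth 0%N [seq nat_of_ord (f j) | j <- enum 'I_n] k =
    f (nth (Ordinal n0) (enum 'I_n) k).
  by move=> kn; apply: (nth_map (Ordinal n0)); rewrite size_enum_ord.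
rewrite !nm //.
have /forallP/(_ (nth (Ordinal n0) (enum 'I_n) i.+1)) := df (nth (Ordinal n0) (enum 'I_n) i).
by rewrite !nth_enum_ord // eqxx.
Qed.

Lemma val_intpart_of f : decr f ->
  val (intpart_of f) = [seq m <- [seq nat_of_ord (f j) | j <- enum 'I_n] | 0 < m]%N.
Proof.
move=> df; rewrite insubdK //; apply/andP; split.
  by apply: sorted_filter (decrP df) => b a c /=; lia.
by rewrite mem_filter ltnn.
Qed.

Lemma size_intpart_of f : decr f -> (size (intpart_of f) <= n)%N.
Proof.
move=> df; rewrite -[parts _]/(val (intpart_of f)) val_intpart_of // size_filter.
by rewrite (leq_trans (count_size _ _)) // size_map size_enum_ord.
Qed.

Lemma part_intpart_of f (j : 'I_n) : decr f -> part (intpart_of f) j = f j.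
Proof.
move=> df; rewrite /part -[parts _]/(val (intpart_of f)) val_intpart_of //.
rewrite nth_filter ?decrP // (nth_map j) ?size_enum_ord //.
by rewrite nth_ord_enum.
Qed.

Definition ffun_of (mu : intpart) : {ffun 'I_n -> 'I_M.+1} :=
  [ffun j => inord (part mu (nat_of_ord j))].

Lemma ffun_ofE mu j : (part mu 0 <= M)%N -> ffun_of mu j = part mu j :> nat.
Proof.
by move=> muM; rewrite ffunE inordK // ltnS (leq_trans _ muM) // part_leq.
Qed.

Lemma decr_ffun_of mu : (part mu 0 <= M)%N -> decr (ffun_of mu).
Proof.
move=> muM; apply/forallP => j; apply/forallP => k; apply/implyP => /eqP kj.
by rewrite !ffun_ofE // part_leq // kj.
Qed.

Lemma ffun_ofK mu : (part mu 0 <= M)%N -> (size mu <= n)%N ->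
  intpart_of (ffun_of mu) = mu.
Proof.
move=> muM mun; have df := decr_ffun_of muM; apply: intpart_eqP => j.
have [jn|nj] := ltnP j n.
  by rewrite -[j]/(nat_of_ord (Ordinal jn)) part_intpart_of // ffun_ofE.
by rewrite !part_default ?(leq_trans _ nj) // size_intpart_of.
Qed.

Lemma intpart_of_inj : {in decr &, injective intpart_of}.
Proof.
move=> f g df dg e; apply/ffunP => j; apply: val_inj => /=.
by rewrite -(part_intpart_of j df) e part_intpart_of.
Qed.

Definition box_partitions : {fset intpart} :=
  [fset mu in [seq intpart_of f | f <- enum (fun f => decr f)]]%fset.

Lemma mem_box_partitions mu : (part mu 0 <= M)%N -> (size mu <= n)%N ->
  mu \in box_partitions.
Proof.
move=> muM mun; rewrite /box_partitions in_fset -(ffun_ofK muM mun); apply: map_f.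
by rewrite mem_enum; apply: decr_ffun_of.
Qed.

Lemma big_box_partitions (V : nmodType) (P : pred intpart) (F : intpart -> V) :
  \sum_(mu <- box_partitions | P mu) F mu =
  \sum_(f : {ffun 'I_n -> 'I_M.+1} | decr f && P (intpart_of f)) F (intpart_of f).
Proof.
have -> : \sum_(mu <- box_partitions | P mu) F mu =
    \sum_(mu <- [seq intpart_of f | f <- enum (fun f => decr f)] | P mu) F mu.
  apply/perm_big/uniq_perm => [||mu]; rewrite ?fset_uniq //; last by rewrite /box_partitions in_fset.
  rewrite map_inj_in_uniq ?enum_uniq // => f g.
  by rewrite !mem_enum; apply: intpart_of_inj.
by rewrite big_map big_enum_cond.
Qed.

End BoxPartitions.

(** * Reduction of infinite sums to identities modulo high order *)

Section SumsToG.
Variables (R : comNzRingType) (a b : R).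

(** For a fixed monomial only the partitions in a finite box contribute: too many rows give
    coefficient 0, and a long first row gives high order. One factor [vdm R n] clears the
    denominators of [Gfin]; the other allows for an identity known only up to a further such
    factor. *)
Lemma sums_to_G (P : pred intpart) (c : intpart -> R) (s : fps R) (n0 : nat) :
  (forall n, (n0 <= n)%N -> exists2 s' : fps R,
     forall m, (nvars m <= n)%N -> coef s m = coef s' m &
     forall M, order_ge M.+1 (vdm R n * (vdm R n * (s' -
       \sum_(f : {ffun 'I_n -> 'I_M.+1} | decr f && P (intpart_of f))
          c (intpart_of f) *: Gfin a b n (intpart_of f))))) ->
  sums_to P (fun mu => c mu *: G a b mu) s.
Proof.
move=> H m; pose n := maxn n0.+1 (nvars m).
have mn : (nvars m <= n)%N by rewrite leq_maxr.
have n0n : (n0 < n)%N by rewrite leq_maxl.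
have [s' ss' Hs] := H n (ltnW n0n); have [e ve] := order_regular_vdm R n.
(* Cancelling each of the two Vandermonde factors costs at most [e] degrees. *)
pose M := (size m + (e + e))%N; exists (box_partitions n M) => B AB.
have vanish mu : mu \notin box_partitions n M -> coef (c mu *: G a b mu) m = 0.
  move=> muA; rewrite fps_coefZ; have [nmu|mun] := ltnP n (size mu).
    by rewrite (coef_G_eq0 _ _ nmu mn) mulr0.
  have Mmu : (M < part mu 0)%N.
    by rewrite ltnNge; apply: contra muA => h; apply: mem_box_partitions.
  rewrite (coef_G _ _ mun mn).
  have : order_ge (size m).+1 (Gfin a b n mu).
    apply: ve; rewrite mulrC Gfin_vdm => m' hm'.
    apply: (@Gnum_order _ a b n mu M.+1) => //; first by lia.
    by apply: leq_trans hm' _; rewrite /M; lia.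
  by move=> -> //; rewrite mulr0.
transitivity (\sum_(mu <- box_partitions n M | P mu) coef (c mu *: G a b mu) m).
  rewrite big_mkcond [RHS]big_mkcond /=; apply/esym/big_fset_incl => // mu _ muA.
  by case: ifP => // _; apply: vanish.
rewrite big_box_partitions ss' //.
have /ve/ve/(_ m (ltnSn _)) : order_ge ((size m).+1 + e + e) (vdm R n *
   (vdm R n * (s' - \sum_(f : {ffun 'I_n -> 'I_M.+1} | decr f && P (intpart_of f))
          c (intpart_of f) *: Gfin a b n (intpart_of f)))).
  by move=> m' hm'; apply: (Hs M); apply: leq_trans hm' _; rewrite /M; lia.
move=> /eqP; rewrite [coef _ m]/= subr_eq0 => /eqP ->; rewrite fps_coef_sum.
apply: eq_bigr => f /andP[df _]; rewrite !fps_coefZ.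
by rewrite (coef_G _ _ (size_intpart_of df) mn).
Qed.

End SumsToG.

Lemma rmorph_row_weight (A B : comNzRingType) (h : {rmorphism A -> B}) g u w lam j m :
  h (row_weight g u w lam j m) = row_weight (h g) (h u) (h w) lam j m.
Proof.
rewrite /row_weight; case: ifP => _; first by rewrite rmorph0.
case: ifP => _; first by rewrite rmorph1.
by case: ifP => _; rewrite !rmorphM !rmorphXn rmorphD.
Qed.

(** The weight of the two-parameter rule. For [lam] included in [mu], the truncated subtractions in
    its exponents are exact. *)
Definition skew_weight (A : comNzRingType) (g u w : A) (mu lam : intpart) : A :=
  if included lam mu then
    (g + u) ^+ (nrows mu lam - ncomps mu lam) *
    g ^+ (nboxes mu lam + ncomps mu lam - (ncols mu lam + nrows mu lam)) *
    (w + u) ^+ ncomps mu lam * w ^+ (ncols mu lam - ncomps mu lam)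
  else 0.

(** If [lam] is not included, some row is too short and has weight 0. *)
Lemma row_weight_intpart_of (A : comNzRingType) (g u w : A) (lam : intpart) n M
    (f : {ffun 'I_n -> 'I_M.+1}) : decr f -> (size lam <= n)%N ->
  \prod_(j < n) row_weight g u w (part lam) j (f j) = skew_weight g u w (intpart_of f) lam.
Proof.
move=> df ln; rewrite /skew_weight; case: ifPn => [inc|].
  rewrite -(row_weight_prod _ _ _ _ (size_intpart_of df)) //.
  by apply: eq_bigr => j _; rewrite part_intpart_of.
case/allPn => j; rewrite mem_iota /= add0n => jl; rewrite -ltnNge => lt.
have jn := leq_trans jl ln; rewrite (bigD1 (Ordinal jn)) //= /row_weight.
by move: lt; rewrite -[j]/(nat_of_ord (Ordinal jn)) part_intpart_of // => ->; rewrite mul0r.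
Qed.

(** * The two-parameter Pieri rule modulo high order *)

Section Truncated.
Variables (R : comNzRingType) (a b : R) (n M : nat) (Q : comNzRingType).
Variable pr : {rmorphism fps R -> Q}.
Hypothesis prP : forall f g, pr f = pr g <-> order_ge M.+1 (f - g).

Let iota : {rmorphism R -> Q} := pr \o in_alg (fps R).
Let x (i : nat) : fps R := fvar i.

Definition yvar (i : nat) : fps R := x i / (1 - a *: x i).

Lemma truncZ c f : pr (c *: f) = iota c * pr f.
Proof. by rewrite -mulr_algl rmorphM. Qed.

Lemma trunc_eq0 f : order_ge M.+1 f -> pr f = 0.
Proof. by move=> h; rewrite -(rmorph0 pr); apply/prP; rewrite subr0. Qed.

(** The parameters are polynomials in an auxiliary variable [t], so that each formula can be read
    off from a coefficient in [t]. *)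
Lemma pieri_truncated (lam : intpart) (u w : {poly R}) : (size lam <= n)%N ->
  \prod_(i < n) (1 + map_poly iota u * (pr (yvar i))%:P) * (pr (Gnum a b n lam))%:P =
  \prod_(i < n) (1 - map_poly iota w * (pr (yvar i))%:P) *
    \sum_(f : {ffun 'I_n -> 'I_M.+1} | decr f)
      map_poly iota (skew_weight (- (a + b))%:P u w (intpart_of f) lam) *
      (pr (Gnum a b n (intpart_of f)))%:P.
Proof.
move=> ln; pose y (i : 'I_n) := (pr (yvar i))%:P.
pose q (i : 'I_n) (j : nat) := (pr (x i ^+ (n - j.+1) * (1 + b *: x i) ^+ j))%:P.
have detE (h : nat -> nat) mu : (forall j, (j < n)%N -> part mu j = h j) ->
    \det (\matrix_(i < n, j < n) (y i ^+ h j * q i j)) = (pr (Gnum a b n mu))%:P.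
  move=> hmu; rewrite /Gnum -!det_map_mx; congr (\det _); apply/matrixP => i j.
  rewrite !mxE -hmu // /y /q -!rmorphXn -!rmorphM; congr (_%:P); congr (pr _).
  rewrite /yvar exprMn exprVn exprD -!mulrA; congr (_ * _).
  by rewrite [RHS]mulrA [RHS]mulrC.
have y_nil i : y i ^+ M.+1 = 0.
  rewrite /y -!rmorphXn trunc_eq0 ?rmorph0 //; apply: order_geX.
  by rewrite /yvar mulrC; apply/order_geMr/order_ge_fvar.
have pr_step (Y S T : fps R) : Y * S = (1 - (- (a + b))%:A * Y) * T ->
    (pr Y)%:P * (pr S)%:P =
    (1 - map_poly iota (- (a + b))%:P * (pr Y)%:P) * (pr T)%:P.
  move=> e; rewrite -polyCM -rmorphM e !rmorphM rmorphB rmorph1 map_polyC /=.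
  by rewrite polyCB polyC1 rmorphM polyCM.
(* This is [(1 + b x) / (1 - a x) = 1 + (a + b) y], where [y = x / (1 - a x)]. *)
have y_q i j : (j.+1 < n)%N ->
    y i * q i j.+1 = (1 - (map_poly iota (- (a + b))%:P) * y i) * q i j.
  move=> jn; apply: pr_step.
  have dU : 1 - a *: x i \is a GRing.unit by apply: unit_fps1BZ.
  apply: (mulrI dU); rewrite /yvar.
  have -> : (n - j.+1 = (n - j.+2).+1)%N by lia.
  have sA c : c *: x i = c%:A * x i by rewrite mulr_algl.
  rewrite !exprS !sA; rewrite sA in dU; set d := 1 - a%:A * x i in dU *; set X := x i.
  have dX : d * (X / d) = X by rewrite mulrC divrK.
  transitivity (d * (X / d) * (X ^+ (n - j.+2) * ((1 + b%:A * X) * (1 + b%:A * X) ^+ j))).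
    by rewrite -[RHS]mulrA.
  rewrite dX; transitivity ((d + (a + b)%:A * (d * (X / d))) *
      (X * X ^+ (n - j.+2) * (1 + b%:A * X) ^+ j)); last first.
    by rewrite scaleNr mulNr opprK [RHS]mulrA mulrDr mulr1 [d * ((a + b)%:A * _)]mulrCA.
  rewrite dX scalerDl (_ : d + _ = 1 + b%:A * X); first by ring.
  by rewrite mulrDl /d addrA subrK.
have := det_pieri (map_poly iota u) (map_poly iota w) y_nil y_q
  (fun j => part_leq lam (leqnSn j)).
rewrite (detE (part lam) lam) // => ->; congr (_ * _).
apply: eq_bigr => f df; rewrite -row_weight_intpart_of // rmorph_prod; congr (_ * _).
  by apply: eq_bigr => j _; rewrite /= (rmorph_row_weight (map_poly iota)).
by rewrite -(@detE (part (intpart_of f)) (intpart_of f)) //; congr (\det _);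
  apply/matrixP => i j; rewrite !mxE part_intpart_of.
Qed.

(** If the first row of [mu0] exceeds [M], then [mu0] is outside the box, and both sides vanish by
    [Gnum_order]. *)
Lemma sum_single_intpart (mu0 : intpart) : (size mu0 <= n)%N -> (0 < n)%N ->
  \sum_(f : {ffun 'I_n -> 'I_M.+1} | decr f)
    ((intpart_of f == mu0)%:R * pr (Gnum a b n (intpart_of f))) = pr (Gnum a b n mu0).
Proof.
move=> mun n0; have [muM|Mmu] := leqP (part mu0 0) M; last first.
  rewrite trunc_eq0; last exact: Gnum_order.
  apply: big1 => f df; case: eqP => [e|_]; last by rewrite mul0r.
  by rewrite mul1r e trunc_eq0 //; apply: Gnum_order.
rewrite (bigD1 (ffun_of n M mu0)) ?decr_ffun_of //= ffun_ofK // eqxx mul1r.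
rewrite big1 ?addr0 // => f /andP[df fN]; case: eqP => [e|_]; last by rewrite mul0r.
case/negP: fN; apply/eqP/(intpart_of_inj df); first exact: decr_ffun_of.
by rewrite ffun_ofK.
Qed.

End Truncated.

(** The common frame of all six formulas. The factor [pr (vdm R n)] stays on both sides because it
    need not be cancellable in [Q]; it clears the denominator when [sn n] is itself a [Gfin]. *)
Lemma sums_to_mul (R : comNzRingType) (a b : R) (P : pred intpart)
    (c d : intpart -> R) (s : fps R) (lam : intpart) (sn : nat -> fps R) n0 :
  (forall n m, (n0 <= n)%N -> (nvars m <= n)%N -> coef s m = coef (sn n) m) ->
  (forall mu, d mu = if P mu then c mu else 0) ->
  (forall n M (Q : comNzRingType) (pr : {rmorphism fps R -> Q}),
     (forall f g, pr f = pr g <-> order_ge M.+1 (f - g)) ->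
     (n0 <= n)%N -> (size lam <= n)%N -> (0 < n)%N ->
     pr (vdm R n) * (pr (sn n * Gnum a b n lam)) =
     pr (vdm R n) * \sum_(f : {ffun 'I_n -> 'I_M.+1} | decr f)
        pr (d (intpart_of f) *: Gnum a b n (intpart_of f))) ->
  sums_to P (fun mu => c mu *: G a b mu) (s * G a b lam).
Proof.
move=> sE dE H; apply: (@sums_to_G _ a b _ _ _ (maxn n0 (size lam).+1)) => n.
rewrite geq_max => /andP[n0n ln].
exists (sn n * Gfin a b n lam) => [m mn|M].
  rewrite [LHS]coef_fpsM [RHS]coef_fpsM; apply: eq_big_seq => k.
  rewrite in_divisors_of => km; move: mn; rewrite (nvars_divisor _ km) => /andP[kn mkn].
  by rewrite (sE n) // (coef_G _ _ (ltnW ln) mkn).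
have [Q [pr prP]] := truncated_quotient R M.
have n_gt0 : (0 < n)%N by lia.
have := H n M Q pr prP n0n (ltnW ln) n_gt0; rewrite -rmorph_sum -!rmorphM => /prP.
rewrite -mulrBr => h; rewrite (_ : vdm R n * (sn n * _ - _) = sn n * Gnum a b n lam -
  \sum_(f : {ffun 'I_n -> 'I_M.+1} | decr f)
     d (intpart_of f) *: Gnum a b n (intpart_of f)) //.
rewrite mulrBr -Gfin_vdm; congr (_ - _); first by rewrite mulrC -mulrA.
rewrite mulr_sumr big_mkcondr /=; apply: eq_bigr => f df.
by rewrite dE -Gfin_vdm; case: ifP => _; rewrite ?scale0r // mulrC -scalerAl.
Qed.

(** * The Pieri formulas *)

Lemma coef_affine (R : comNzRingType) (s c : R) m d k :
  (s%:P * 'X^d * (c%:P + 'X) ^+ m)`_k =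
  if (k < d)%N then 0 else s * (c ^+ (m - (k - d)) *+ 'C(m, k - d)).
Proof.
rewrite -mulrA coefCM coefXnM; case: ifP => _; first by rewrite mulr0.
congr (_ * _); have -> : (c%:P + 'X) ^+ m =
    \poly_(i < m.+1) (c ^+ (m - i) *+ 'C(m, i)).
  rewrite exprDn poly_def; apply: eq_bigr => i _.
  by rewrite -polyC_exp mul_polyC -scalerMnl.
rewrite coef_poly ltnS; case: leqP => // h.
by rewrite bin_small // mulr0n.
Qed.

Lemma binomz_nat (n m : nat) : binomz n%:Z m%:Z = 'C(n, m)%:Z.
Proof. by []. Qed.

Lemma binomz_subn (n c k : nat) : (n <= c)%N ->
  binomz n%:Z (c%:Z - k%:Z) = if (k + n < c)%N || (c < k)%N then 0 else 'C(n, c - k)%:Z.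
Proof.
move=> nc; case: (ltnP c k) => [ck|kc].
  rewrite orbT; have -> : c%:Z - k%:Z = Negz (k - c).-1 by lia.
  by [].
rewrite orbF; have -> : c%:Z - k%:Z = (c - k)%N%:Z by lia.
by rewrite binomz_nat; case: ltnP => // h; rewrite bin_small //; lia.
Qed.

Lemma coef_pieri_sum (R : comNzRingType) (a b : R) n M (Q : comNzRingType)
    (pr : {rmorphism fps R -> Q}) (wt : intpart -> {poly R}) k :
  (\sum_(f : {ffun 'I_n -> 'I_M.+1} | decr f)
     map_poly (pr \o in_alg (fps R)) (wt (intpart_of f)) *
     (pr (Gnum a b n (intpart_of f)))%:P)`_k =
  \sum_(f : {ffun 'I_n -> 'I_M.+1} | decr f)
     pr ((wt (intpart_of f))`_k *: Gnum a b n (intpart_of f)).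
Proof.
rewrite coef_sum; apply: eq_bigr => f _.
by rewrite coefMC coef_map truncZ.
Qed.

(** * Multiplication by complete and elementary symmetric functions *)

Section Types23.
Variables (R : comUnitRingType) (al be : R) (lam : intpart).

Let g := al + be.
Let gE : - (- al + - be) = g. Proof. by rewrite -opprD opprK. Qed.
Let y := yvar (- al).

Let yE : (fun i : nat => fvar i / (1 + al *: fvar i)) = y.
Proof. by apply/funext => i; rewrite /y /yvar scaleNr opprK. Qed.

Lemma restrict_yvar (a : R) n : restrict n (yvar a n) = 0.
Proof. by rewrite rmorphM /= restrict_fvar ltnn mul0r. Qed.

Lemma restrict_fvar0 n : restrict n (fvar n : fps R) = 0.
Proof. by rewrite restrict_fvar ltnn. Qed.

Let xy i : (1 - al *: y i) * (1 + al *: fvar i) = 1 :> fps R.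
Proof.
have dU : 1 + al *: fvar i \is a @GRing.unit (fps R).
  by have := @unit_fps1BZ R (- al) i; rewrite scaleNr opprK.
have e : y i * (1 + al *: fvar i) = fvar i by rewrite -yE divrK.
by rewrite mulrBl mul1r -scalerAl e addrK.
Qed.

(** The inverse substitution [x = y / (1 - al y)], free of division. *)
Let xyE i : fvar i * (1 - al *: y i) = y i :> fps R.
Proof.
have dU : 1 + al *: fvar i \is a @GRing.unit (fps R).
  by have := @unit_fps1BZ R (- al) i; rewrite scaleNr opprK.
by apply: (mulIr dU); rewrite -mulrA xy mulr1 -yE divrK.
Qed.

(** Take [u = 0] and [w = t]. The weight becomes [g^(r - p + i) t^c], and [r - p + i] is the number
    of boxes minus [c]. *)
Lemma hsymf_yvar_pieri k :
  sums_to (fun nu => included lam nu && (ncols nu lam == k))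
    (fun nu => g ^ ((nboxes nu lam)%:Z - k%:Z) *: G (- al) (- be) nu)
    (hsymf k (fun i => fvar i / (1 + al *: fvar i)) * G (- al) (- be) lam).
Proof.
rewrite yE; apply: (@sums_to_mul _ _ _ _ _
  (fun mu => (skew_weight g%:P 0 'X mu lam)`_k) _ _ (fun n => hfin n k y) 0).
- by move=> n m _; apply: coef_hsymf; apply: restrict_yvar.
- move=> mu; rewrite /skew_weight; case: ifP => inc /=; last by rewrite coef0.
  have h1 := ncomps_le_nrows inc; have h2 := ncomps_le_ncols inc.
  have h3 := nrows_ncols_le inc; have h4 := ncols_le_nboxes inc.
  rewrite !addr0 -!polyC_exp -polyCM -exprD -mulrA -exprD coefCM coefXn.
  rewrite subnKC // eq_sym; case: eqP => [<-|_]; last by rewrite mulr0.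
  rewrite mulr1 subzn // -exprnP; congr (_ ^+ _); lia.
move=> n M Q pr prP _ ln _; congr (_ * _).
have := pieri_truncated (- al) (- be) prP 0 'X ln.
rewrite gE rmorph0 /= map_polyX; rewrite big1 ?mul1r; last first.
  by move=> i _; rewrite mul0r addr0.
move=> /esym/(@hfin_gen _ n (pr \o y) _ _ k).
rewrite (@coef_pieri_sum _ (- al) (- be) n M Q pr
    (fun mu => skew_weight g%:P 0 'X mu lam)) => ->; rewrite rmorphM; congr (_ * _).
exact: rmorph_symfin.
Qed.

(** Take [u = t] and [w = 0]. The factor [0^(c - p)] selects vertical strips, for which [i = 0], and
    the weight becomes [t^c (g + t)^(r - c)] with [r] the number of boxes. *)
Lemma esymf_yvar_pieri k :
  sums_to (fun nu => included lam nu && vertical_strip nu lam)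
    (fun nu => (g ^ ((nboxes nu lam)%:Z - k%:Z) *
      (binomz ((nboxes nu lam)%:Z - (ncols nu lam)%:Z)
              (k%:Z - (ncols nu lam)%:Z))%:~R) *: G (- al) (- be) nu)
    (esymf k (fun i => fvar i / (1 + al *: fvar i)) * G (- al) (- be) lam).
Proof.
rewrite yE; apply: (@sums_to_mul _ _ _ _ _
  (fun mu => (skew_weight g%:P 'X 0 mu lam)`_k) _ _ (fun n => efin n k y) 0).
- by move=> n m _; apply: coef_esymf; apply: restrict_yvar.
- move=> mu; rewrite /skew_weight; case: ifP => inc /=; last by rewrite coef0.
  have h1 := ncomps_le_nrows inc; have h2 := ncomps_le_ncols inc.
  have h3 := nrows_ncols_le inc; have h4 := ncols_le_nboxes inc.
  case: ifP => v; last first.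
    move/negbT: v; rewrite vertical_strip_ncomps // => v.
    have -> : (ncols mu lam - ncomps mu lam = (ncols mu lam - ncomps mu lam).-1.+1)%N.
      by lia.
    by rewrite expr0n mulr0 coef0.
  have N := vertical_strip_nboxes inc v.
  move: v; rewrite vertical_strip_ncomps // => /eqP c.
  rewrite -c subnn expr0 mulr1 add0r -N addnC subnn expr0 mulr1.
  rewrite mulrC -['X^_]mul1r -polyC1 coef_affine (subzn h4).
  case: ltnP => kc.
    have -> : k%:Z - (ncols mu lam)%:Z = Negz (ncols mu lam - k).-1 by lia.
    by rewrite mulr0.
  rewrite mul1r (subzn kc) binomz_nat; have [kN|Nk] := leqP k (nboxes mu lam).
    by rewrite (subzn kN) -exprnP mulr_natr; congr (_ ^+ _ *+ _); lia.
  by rewrite bin_small ?mulr0n ?mulr0 //; lia.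
move=> n M Q pr prP _ ln _; congr (_ * _).
have := pieri_truncated (- al) (- be) prP 'X 0 ln.
rewrite gE rmorph0 /= map_polyX [in RHS]big1 ?mul1r; last first.
  by move=> i _; rewrite mul0r subr0.
move=> /(congr1 (fun p : {poly Q} => p`_k)); rewrite (@coef_pieri_sum _ (- al) (- be) n M Q pr
    (fun mu => skew_weight g%:P 'X 0 mu lam)) coefMC => <-.
rewrite rmorphM (efin_gen n (pr \o y) k); congr (_ * _).
exact: rmorph_symfin.
Qed.

Let cancel_al (Q : comNzRingType) (pr : {rmorphism fps R -> Q}) n (P1 P2 : {poly Q}) :
  \prod_(i < n) (1 - (pr (al *: y i))%:P) * P1 =
  \prod_(i < n) (1 - (pr (al *: y i))%:P) * P2 -> P1 = P2.
Proof.
move=> e; have c : \prod_(i < n) (1 + (pr (al *: fvar i))%:P) *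
    \prod_(i < n) (1 - (pr (al *: y i))%:P) = 1.
  rewrite -big_split big1 // => i _ /=.
  by rewrite -polyC1 -polyCD -polyCB -polyCM -(rmorph1 pr) -rmorphD -rmorphB -rmorphM
    mulrC xy.
by rewrite -[P1]mul1r -c -mulrA e mulrA c mul1r.
Qed.

Let map_affine (Q : comNzRingType) (pr : {rmorphism fps R -> Q}) (c : R) i :
  map_poly (pr \o in_alg (fps R)) c%:P * (pr (y i))%:P = (pr (c *: y i))%:P.
Proof. by rewrite map_polyC -polyCM truncZ. Qed.

Let map_addX (Q : comNzRingType) (pr : {rmorphism fps R -> Q}) (c : {poly R}) :
  map_poly (pr \o in_alg (fps R)) (c + 'X) = map_poly (pr \o in_alg (fps R)) c + 'X.
Proof. by rewrite rmorphD /= map_polyX. Qed.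

Let map_subX (Q : comNzRingType) (pr : {rmorphism fps R -> Q}) (c : {poly R}) :
  map_poly (pr \o in_alg (fps R)) ('X - c) = 'X - map_poly (pr \o in_alg (fps R)) c.
Proof. by rewrite rmorphB /= map_polyX. Qed.

Let pr_xyE (Q : comNzRingType) (pr : {rmorphism fps R -> Q}) i :
  (pr (fvar i))%:P * (1 - (pr (al *: y i))%:P) = (pr (y i))%:P.
Proof.
by rewrite -polyC1 -polyCB -polyCM -(rmorph1 pr) -rmorphB -rmorphM xyE.
Qed.

(** Symmetry of binomial coefficients turns the lower index [k - p] of the expansion into
    [r - k]. *)
Let vexp (c s : R) (r p k : nat) : (p <= r)%N ->
  (if (k < p)%N then 0 else s * (c ^+ (r - p - (k - p)) *+ 'C(r - p, k - p))) =
  s * c ^ (r%:Z - k%:Z) * (binomz (r%:Z - p%:Z) (r%:Z - k%:Z))%:~R.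
Proof.
move=> pr; rewrite (subzn pr) binomz_subn ?leq_subr //.
have [kp|pk] := ltnP k p.
  by rewrite ifT ?mulr0 //; lia.
have [rk|kr] := ltnP r k; first by rewrite orbT bin_small ?mulr0n ?mulr0 //; lia.
rewrite ifF; last by lia.
rewrite subzn // -exprnP -mulrA mulr_natr; congr (_ * (_ ^+ _ *+ _)); first by lia.
by rewrite -bin_sub; [congr 'C(_, _); lia|lia].
Qed.

(** Take [u = - al] and [w = al + t]: then [(1 + u y) / (1 - w y) = 1 / (1 - t x)], and the weight
    is [be^(r - p) g^i t^p (al + t)^(c - p)]. *)
Lemma hsymf_pieri k :
  sums_to predT (fun mu => vcoef al be k mu lam *: G (- al) (- be) mu)
    (hsymf k fvar * G (- al) (- be) lam).
Proof.
apply: (@sums_to_mul _ _ _ _ _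
  (fun mu => (skew_weight g%:P (- al%:P) (al%:P + 'X) mu lam)`_k) _ _
  (fun n => hfin n k fvar) 0).
- by move=> n m _; apply: coef_hsymf; apply: restrict_fvar0.
- move=> mu; rewrite /skew_weight /vcoef /=; case: ifP => inc; last by rewrite coef0.
  have h1 := ncomps_le_nrows inc; have h2 := ncomps_le_ncols inc.
  have h3 := nrows_ncols_le inc.
  have -> : g%:P - al%:P = be%:P by rewrite -polyCB /g addrC addKr.
  have -> : al%:P + 'X - al%:P = 'X by rewrite addrC addKr.
  rewrite -!polyC_exp -polyCM coef_affine vexp //; congr (_ * _ * _).
  have -> : ninner mu lam = (nboxes mu lam + ncomps mu lam - (ncols mu lam + nrows mu lam))%N%:Z.
    by rewrite /ninner; lia.
  by rewrite subzn // -!exprnP.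
move=> n M Q pr prP _ ln _; congr (_ * _).
have := pieri_truncated (- al) (- be) prP (- al%:P) (al%:P + 'X) ln.
rewrite gE; set S := \sum_(f | _) _ => e.
suff : \prod_(i < n) (1 - 'X * (pr (fvar i))%:P) * S = (pr (Gnum (- al) (- be) n lam))%:P.
  move=> /(@hfin_gen _ n (pr \o fvar) _ _ k).
  rewrite (@coef_pieri_sum _ (- al) (- be) n M Q pr
    (fun mu => skew_weight g%:P (- al%:P) (al%:P + 'X) mu lam)) => ->; rewrite rmorphM; congr (_ * _).
  exact: rmorph_symfin.
apply: (@cancel_al _ pr n); rewrite mulrA -big_split.
transitivity (\prod_(i < n) (1 - map_poly (pr \o in_alg (fps R)) (al%:P + 'X) *
    (pr (y i))%:P) * S).
  congr (_ * _); apply: eq_bigr => i _; rewrite map_addX mulrDl map_affine.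
  by rewrite -(pr_xyE pr i) /=; ring.
rewrite -e; congr (_ * _); apply: eq_bigr => i _.
by rewrite rmorphN mulNr map_affine.
Qed.

(** Take [u = t - al] and [w = al]: then [(1 + u y) / (1 - w y) = 1 + t x], and the weight is
    [(be + t)^(r - p) g^i t^p al^(c - p)]. *)
Lemma esymf_pieri k :
  sums_to predT (fun mu => vbarcoef al be k mu lam *: G (- al) (- be) mu)
    (esymf k fvar * G (- al) (- be) lam).
Proof.
apply: (@sums_to_mul _ _ _ _ _
  (fun mu => (skew_weight g%:P ('X - al%:P) al%:P mu lam)`_k) _ _
  (fun n => efin n k fvar) 0).
- by move=> n m _; apply: coef_esymf; apply: restrict_fvar0.
- move=> mu; rewrite /skew_weight /vbarcoef /=; case: ifP => inc; last by rewrite coef0.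
  have h1 := ncomps_le_nrows inc; have h2 := ncomps_le_ncols inc.
  have h3 := nrows_ncols_le inc.
  have -> : g%:P + ('X - al%:P) = be%:P + 'X.
    by rewrite addrCA -polyCB /g [al + _]addrC addrK addrC.
  have -> : al%:P + ('X - al%:P) = 'X by rewrite addrC subrK.
  set i := (nboxes mu lam + _ - _)%N.
  transitivity (((al ^+ (ncols mu lam - ncomps mu lam) * g ^+ i)%:P *
    'X^(ncomps mu lam) * (be%:P + 'X) ^+ (nrows mu lam - ncomps mu lam))`_k).
    by rewrite polyCM !polyC_exp; congr (nth _ (polyseq _) _); ring.
  rewrite coef_affine vexp //; congr (_ * _ * _).
  have -> : ninner mu lam = i%:Z by rewrite /ninner /i; lia.
  by rewrite subzn // -!exprnP.
move=> n M Q pr prP _ ln _; congr (_ * _).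
have := pieri_truncated (- al) (- be) prP ('X - al%:P) al%:P ln.
rewrite gE; set S := \sum_(f | _) _ => e.
suff : \prod_(i < n) (1 + 'X * (pr (fvar i))%:P) * (pr (Gnum (- al) (- be) n lam))%:P = S.
  move=> /(congr1 (fun p : {poly Q} => p`_k)).
  rewrite /S (@coef_pieri_sum _ (- al) (- be) n M Q pr
    (fun mu => skew_weight g%:P ('X - al%:P) al%:P mu lam)) coefMC => <-.
  rewrite rmorphM (efin_gen n (pr \o fvar) k); congr (_ * _).
  exact: rmorph_symfin.
apply: (@cancel_al _ pr n); rewrite mulrA -big_split.
transitivity (\prod_(i < n) (1 + map_poly (pr \o in_alg (fps R)) ('X - al%:P) *
    (pr (y i))%:P) * (pr (Gnum (- al) (- be) n lam))%:P).
  congr (_ * _); apply: eq_bigr => i _; rewrite map_subX mulrBl map_affine.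
  by rewrite -(pr_xyE pr i) /=; ring.
by rewrite e; congr (_ * _); apply: eq_bigr => i _; rewrite map_affine.
Qed.

End Types23.

(** * One-row and one-column shapes as strips over the empty partition *)

Section OneRowColumn.

Notation nil_part := (one_row 0).

Lemma part_one_row k j : part (one_row k) j = if j == 0%N then k else 0%N.
Proof. by case: k => [|k]; case: j => [|[]]. Qed.

Lemma part_one_column k j : part (one_column k) j = (j < k)%N.
Proof. by rewrite /part nth_nseq; case: ifP. Qed.

Lemma included_nil mu : included nil_part mu.
Proof. by []. Qed.

Lemma nrows_nil (mu : intpart) : nrows mu nil_part = size mu.
Proof.
rewrite (nrowsE (included_nil mu) (leqnn _)).
under eq_bigr => j _ do rewrite /rlen part_one_row if_same subn0 ipart_gt0 //.
by rewrite sum1_card card_ord.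
Qed.

Lemma ncols_nil mu : ncols mu nil_part = part mu 0.
Proof.
rewrite (ncolsE (included_nil mu) (leqnSn _)) big_ord_recl big1 => [|j _].
  by rewrite /rlen part_one_row /= !subn0 addn0.
by rewrite /rlen /ovl /= !part_one_row if_same !subn0 subnn.
Qed.

Lemma one_row_strip mu k : (0 < k)%N ->
  (mu == one_row k) =
  [&& horizontal_strip mu nil_part, nboxes mu nil_part == k & nrows mu nil_part == 1%N].
Proof.
move=> k0; have inc := included_nil mu.
apply/eqP/and3P => [->|[h /eqP N /eqP r]].
  have ink := included_nil (one_row k).
  have s1 : size (one_row k) = 1%N by case: (k) k0.
  have h : horizontal_strip (one_row k) nil_part.
    by rewrite (horizontal_stripE ink (leqnn _)) s1 big_ord1.
  split=> //; last by rewrite nrows_nil s1.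
  by rewrite (horizontal_strip_nboxes ink h) ncols_nil part_one_row.
apply: intpart_eqP => j; rewrite part_one_row.
case: j => [|j] /=; first by rewrite -ncols_nil -(horizontal_strip_nboxes inc h).
by rewrite part_default //; move: r; rewrite nrows_nil => ->.
Qed.

Lemma horizontal_nil_nrows mu : horizontal_strip mu nil_part -> (nrows mu nil_part <= 1)%N.
Proof.
rewrite (horizontal_stripE (included_nil mu) (leqnn _)) nrows_nil sum_nat_eq0.
move=> /forallP h; rewrite leqNgt; apply/negP => s1.
have /eqP := implyP (h (Ordinal s1)) isT; rewrite /= part_one_row subn0.
by have := ipart_gt0 s1; lia.
Qed.

Lemma one_column_strip mu k : (0 < k)%N ->
  (mu == one_column k) =
  [&& vertical_strip mu nil_part, nboxes mu nil_part == k & ncols mu nil_part == 1%N].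
Proof.
move=> k0; have inc := included_nil mu.
apply/eqP/and3P => [->|[v /eqP N /eqP c]].
  have ink := included_nil (one_column k).
  have v : vertical_strip (one_column k) nil_part.
    rewrite (vertical_stripE ink (leqnn _)) big1 // => j _.
    by rewrite /rlen part_one_row if_same part_one_column subn0; case: ltnP.
  split=> //; last by rewrite ncols_nil part_one_column k0.
  by rewrite (vertical_strip_nboxes ink v) nrows_nil /= size_nseq.
have sk : size mu = k by rewrite -nrows_nil -(vertical_strip_nboxes inc v).
apply: intpart_eqP => j; rewrite part_one_column.
case: ltnP => jk; last by rewrite part_default // sk.
have := part_leq mu (leq0n j); rewrite -ncols_nil c.
by have := @ipart_gt0 mu j; rewrite sk jk => /(_ isT); lia.
Qed.

Lemma vertical_nil_ncols mu : vertical_strip mu nil_part -> (ncols mu nil_part <= 1)%N.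
Proof.
rewrite (vertical_stripE (included_nil mu) (leqnSn _)) ncols_nil sum_nat_eq0.
move=> /forallP /(_ ord0) /implyP/(_ isT).
by rewrite /rlen part_one_row /= subn0; case: (part mu 0) => [|[]].
Qed.

End OneRowColumn.

Lemma nrows_gt0 mu lam : (0 < nboxes mu lam)%N -> (0 < nrows mu lam)%N.
Proof.
rewrite /nboxes /nrows -(size_map fst (boxes mu lam)) !lt0n !size_eq0.
by apply: contra => /eqP/undup_nil ->.
Qed.

Lemma ncols_gt0 mu lam : (0 < nboxes mu lam)%N -> (0 < ncols mu lam)%N.
Proof.
rewrite /nboxes /ncols -(size_map snd (boxes mu lam)) !lt0n !size_eq0.
by apply: contra => /eqP/undup_nil ->.
Qed.

(** * Multiplication by [G] of one row or one column *)

Section Type1.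
Variables (R : comUnitRingType) (al be : R).

Let g := al + be.

Definition strip_coef (r N k : nat) : R :=
  g ^ (N%:Z - k%:Z) * (binomz (r%:Z - 1) (N%:Z - k%:Z))%:~R.

(* [((X + g)^r X^(N - r) - [N = 0]) / (X + g)] *)
Definition strip_poly (r N : nat) : {poly R} :=
  if N == 0%N then 0 else 'X^(N - r) * (g%:P + 'X) ^+ r.-1.

Lemma strip_polyE r N : (r <= N)%N -> ((0 < N) ==> (0 < r))%N ->
  'X^(N - r) * (g%:P + 'X) ^+ r = (N == 0%N)%:R + (g%:P + 'X) * strip_poly r N.
Proof.
case: N => [|N]; first by rewrite leqn0 => /eqP -> _; rewrite mulr0 addr0 mulr1.
by move=> _ /= r0; rewrite add0r mulrCA -exprS prednK.
Qed.

Lemma coef_strip_poly r N k : (r <= N)%N -> ((0 < N) ==> (0 < r))%N -> (0 < k)%N ->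
  (strip_poly r N)`_k.-1 = strip_coef r N k.
Proof.
move=> rN Nr k0; rewrite /strip_poly /strip_coef; case: posnP => [N0|N0].
  have -> : N%:Z - k%:Z = Negz k.-1 by lia.
  by rewrite coef0 mulr0.
have r0 := implyP Nr N0.
rewrite -['X^_]mul1r -polyC1 coef_affine.
have -> : r%:Z - 1 = r.-1%:Z by lia.
have [kN|Nk] := leqP k N; last first.
  have -> : N%:Z - k%:Z = Negz (k - N).-1 by lia.
  by rewrite mulr0 ifF ?bin_small ?mulr0n ?mulr0 //; lia.
rewrite (subzn kN) binomz_nat mul1r; case: ltnP => h.
  by rewrite bin_small ?mulr0 //; lia.
rewrite -exprnP mulr_natr; congr (_ ^+ _ *+ _); first by lia.
by rewrite -bin_sub; [congr 'C(_, _); lia|lia].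
Qed.

(* [single], [strip], [stat] are either (k), horizontal strips, number of rows,
   or (1^k), vertical strips, number of columns. *)
Lemma G_strip_pieri (strip : rel intpart) (stat : intpart -> intpart -> nat)
    (u w : {poly R}) (single : intpart) k (lam : intpart) :
  (0 < k)%N -> w = 'X \/ w = 0 ->
  (forall mu nu, included nu mu -> skew_weight (- g)%:P u w mu nu =
     if strip mu nu then 'X^(nboxes mu nu - stat mu nu) * (g%:P + 'X) ^+ stat mu nu
     else 0) ->
  (forall nu, strip nu nu) ->
  (forall mu nu, included nu mu -> strip mu nu -> (stat mu nu <= nboxes mu nu)%N) ->
  (forall mu nu, (0 < nboxes mu nu)%N -> (0 < stat mu nu)%N) ->
  (forall mu, (mu == single) = [&& strip mu (one_row 0),
      nboxes mu (one_row 0) == k & stat mu (one_row 0) == 1%N]) ->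
  (forall mu, strip mu (one_row 0) -> stat mu (one_row 0) <= 1)%N ->
  sums_to (fun mu => included lam mu && strip mu lam)
    (fun mu => strip_coef (stat mu lam) (nboxes mu lam) k *: G al be mu)
    (G al be single * G al be lam).
Proof.
move=> k0 wE weightE stripxx stat_le stat_gt0 singleE stat_le1.
(* The weight minus its diagonal term, divided by [g + t]; its coefficient of [t^(k-1)] is the
   coefficient in the formula. *)
pose v mu nu := if included nu mu && strip mu nu
  then strip_poly (stat mu nu) (nboxes mu nu) else 0.
have vE mu nu : skew_weight (- g)%:P u w mu nu =
    (mu == nu)%:R + (g%:P + 'X) * v mu nu.
  rewrite /v; case inc: (included nu mu); last first.
    rewrite {1}/skew_weight inc /= mulr0 addr0; case: eqP => // e.
    by move: inc; rewrite e; have /includedP -> : forall j, (part nu j <= part nu j)%N by [].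
  rewrite weightE //= -nboxes_eq0 //; case: ifP => st.
    by rewrite strip_polyE ?stat_le //; apply/implyP; apply: stat_gt0.
  rewrite mulr0 addr0; case: eqP => // /eqP; rewrite nboxes_eq0 // => /eqP e.
  by move: st; rewrite e stripxx.
have vk mu nu : (v mu nu)`_k.-1 = if included nu mu && strip mu nu
    then strip_coef (stat mu nu) (nboxes mu nu) k else 0.
  rewrite /v; case: ifP => [/andP[inc st]|_]; last by rewrite coef0.
  by rewrite coef_strip_poly ?stat_le //; apply/implyP; apply: stat_gt0.
(* Over the empty partition [stat] is at most 1, so the binomial coefficient leaves only shapes with
   [k] boxes. Thus the rule for the empty partition isolates [single]. *)
have v0 mu : (v mu (one_row 0))`_k.-1 = (mu == single)%:R.
  rewrite vk singleE included_nil /=; case: ifP => //= st.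
  have := stat_le1 _ st; rewrite /strip_coef leq_eqVlt ltnS leqn0.
  case/orP => /eqP s1; rewrite s1 /=.
    rewrite andbT; case: (ltngtP (nboxes mu (one_row 0)) k) => [lt|gt|->].
    - have -> : (nboxes mu (one_row 0))%:Z - k%:Z = Negz (k - nboxes mu (one_row 0)).-1.
        by lia.
      by rewrite mulr0.
    - by rewrite (subzn (ltnW gt)) binomz_nat bin_small ?mulr0 // subn_gt0.
    by rewrite !subrr mulr1.
  have := @stat_gt0 mu (one_row 0); rewrite s1; case: posnP => [-> _|_ /(_ isT)//].
  have -> : 0%N%:Z - k%:Z = Negz k.-1 by lia.
  by rewrite mulr0 andbF.
apply: (@sums_to_mul R al be _ _ (fun mu => (v mu lam)`_k.-1) _ lam
   (fun n => Gfin al be n single) (size single)) => [n m sn mn|mu|n M Q pr prP sn ln n0].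
- exact: coef_G.
- exact: vk.
have pierE (nu : intpart) (ln' : (size nu <= n)%N) := pieri_truncated al be prP u w ln'.
pose V (nu : intpart) := \sum_(f : {ffun 'I_n -> 'I_M.+1} | decr f)
   map_poly (pr \o in_alg (fps R)) (v (intpart_of f) nu) *
   (pr (Gnum al be n (intpart_of f)))%:P.
pose E1 := \prod_(i < n) (1 + map_poly (pr \o in_alg (fps R)) u * (pr (yvar al i))%:P).
pose E2 := \prod_(i < n) (1 - map_poly (pr \o in_alg (fps R)) w * (pr (yvar al i))%:P).
pose L := map_poly (pr \o in_alg (fps R)) (g%:P + 'X).
have VE (nu : intpart) : (size nu <= n)%N ->
    E1 * (pr (Gnum al be n nu))%:P = E2 * ((pr (Gnum al be n nu))%:P + L * V nu).
  move=> nun; rewrite (pierE nu nun); congr (_ * _).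
  rewrite -(sum_single_intpart al be prP nun n0) rmorph_sum /V mulr_sumr -big_split.
  apply: eq_bigr => f df /=; rewrite vE rmorphD rmorphM rmorph_nat mulrDl mulrA.
  by congr (_ + _); rewrite polyCM polyC_natr.
have E2reg (P : {poly Q}) : E2 * P = 0 -> P = 0.
  rewrite /E2; case: wE => ->.
    rewrite map_polyX => h; apply/polyP => j; rewrite coef0.
    rewrite -(polyC0) in h; have := @hfin_gen _ n (pr \o yvar al) _ _ j h.
    by rewrite mulr0.
  rewrite rmorph0 big1 ?mul1r // => i _.
  by rewrite mul0r subr0.
have Lreg : GRing.lreg L.
  apply: monic_lreg; rewrite /L rmorphD /= map_polyX map_polyC addrC.
  exact: monicXaddC.
have nil_n : (size (one_row 0) <= n)%N by [].
(* The rules for [lam] and for the empty partition, whose numerator is [vdm R n], are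
   cross-multiplied to eliminate [E1]; then [E2] and the monic [L] are cancelled. *)
have key : (pr (vdm R n))%:P * V lam = (pr (Gnum al be n lam))%:P * V (one_row 0).
  apply: Lreg; apply/eqP; rewrite -subr_eq0; apply/eqP/E2reg.
  rewrite -(Gnum_nil al be n (erefl : size (one_row 0) = 0%N)).
  have e1 := VE lam ln; have e2 := VE _ nil_n.
  set A := (pr _)%:P in e1 e2 *; set B := (pr _)%:P in e1 e2 *.
  transitivity (B * (E2 * (A + L * V lam)) - A * (E2 * (B + L * V (one_row 0)))).
    by ring.
  by rewrite -e1 -e2; ring.
have := congr1 (fun p : {poly Q} => p`_k.-1) key.
rewrite /= !coefCM.
rewrite /V (@coef_pieri_sum _ al be n M Q pr (v^~ lam)).
rewrite (@coef_pieri_sum _ al be n M Q pr (v^~ (one_row 0))) => ->.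
have -> : \sum_(f : {ffun 'I_n -> 'I_M.+1} | decr f)
    pr ((v (intpart_of f) (one_row 0))`_k.-1 *: Gnum al be n (intpart_of f)) =
    pr (Gnum al be n single).
  rewrite -(sum_single_intpart al be prP sn n0); apply: eq_bigr => f _.
  by rewrite v0 truncZ rmorph_nat.
by rewrite -!rmorphM -[Gnum _ _ _ single]Gfin_vdm; congr (pr _); ring.
Qed.

(** The first parameter of the weight is [- g] here. With [u = g] the factor [0^(r - p)] selects
    horizontal strips, where [i = 0] and [p = r]; with [w = t] the weight is
    [t^(c - r) (g + t)^r]. *)
Lemma G_row_pieri k (lam : intpart) : (0 < k)%N ->
  sums_to (fun mu => included lam mu && horizontal_strip mu lam)
    (fun mu => strip_coef (nrows mu lam) (nboxes mu lam) k *: G al be mu)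
    (G al be (one_row k) * G al be lam).
Proof.
move=> k0; apply: (@G_strip_pieri horizontal_strip nrows g%:P 'X) => //.
- by left.
- move=> mu nu inc; rewrite /skew_weight inc -polyCD addNr.
  case: ifP => h; last first.
    move/negbT: h; rewrite horizontal_strip_ncomps // => h.
    have := ncomps_le_nrows inc => h1.
    have -> : (nrows mu nu - ncomps mu nu = (nrows mu nu - ncomps mu nu).-1.+1)%N by lia.
    by rewrite expr0n !mul0r.
  have N := horizontal_strip_nboxes inc h.
  move: h; rewrite horizontal_strip_ncomps // => /eqP r.
  by rewrite -r subnn expr0 mul1r -N subnn expr0 mul1r mulrC [g%:P + _]addrC.
- move=> nu; have inc : included nu nu by apply/includedP.
  rewrite horizontal_strip_ncomps //; have := nboxes_eq0 inc; rewrite eqxx => /eqP N.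
  have := nrows_ncols_le inc; have := ncomps_le_nrows inc; rewrite N; lia.
- move=> mu nu inc h; have := nrows_ncols_le inc; have := ncomps_le_ncols inc.
  by rewrite (horizontal_strip_nboxes inc h); move: h; rewrite horizontal_strip_ncomps //; lia.
- by move=> mu nu; apply: nrows_gt0.
- by move=> mu; apply: one_row_strip.
exact: horizontal_nil_nrows.
Qed.

(** With [w = 0] only vertical strips remain, where [i = 0] and [p = c]; with [u = g + t] the weight
    is [t^(r - c) (g + t)^c]. *)
Lemma G_column_pieri k (lam : intpart) : (0 < k)%N ->
  sums_to (fun mu => included lam mu && vertical_strip mu lam)
    (fun mu => strip_coef (ncols mu lam) (nboxes mu lam) k *: G al be mu)
    (G al be (one_column k) * G al be lam).
Proof.
move=> k0; apply: (@G_strip_pieri vertical_strip ncols (g%:P + 'X) 0) => //.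
- by right.
- move=> mu nu inc; rewrite /skew_weight inc add0r addrA -polyCD addNr add0r.
  have h1 := ncomps_le_ncols inc; case: ifP => h; last first.
    move/negbT: h; rewrite vertical_strip_ncomps // => h.
    have -> : (ncols mu nu - ncomps mu nu = (ncols mu nu - ncomps mu nu).-1.+1)%N by lia.
    by rewrite expr0n mulr0.
  have N := vertical_strip_nboxes inc h.
  move: h; rewrite vertical_strip_ncomps // => /eqP r.
  by rewrite -r subnn expr0 mulr1 -N addnC subnn expr0 mulr1.
- move=> nu; have inc : included nu nu by apply/includedP.
  rewrite vertical_strip_ncomps //; have := nboxes_eq0 inc; rewrite eqxx => /eqP N.
  by have := ncols_le_nboxes inc; have := ncomps_le_ncols inc; rewrite N; lia.
- by move=> mu nu inc _; apply: ncols_le_nboxes.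
- by move=> mu nu; apply: ncols_gt0.
- by move=> mu; apply: one_column_strip.
exact: vertical_nil_ncols.
Qed.

End Type1.

Theorem theorem8p1 (lam : intpart) :
  (* Type 1 *)
  (forall k : nat, (1 <= k)%N ->
    sums_to (fun mu => included lam mu && horizontal_strip mu lam)
      (fun mu =>
        ((alpha + beta) ^ ((nboxes mu lam)%:Z - k%:Z)
         * (binomz ((nrows mu lam)%:Z - 1)
                   ((nboxes mu lam)%:Z - k%:Z))%:~R)
        *: G alpha beta mu)
      (G alpha beta (one_row k) * G alpha beta lam)
    /\
    sums_to (fun mu => included lam mu && vertical_strip mu lam)
      (fun mu =>
        ((alpha + beta) ^ ((nboxes mu lam)%:Z - k%:Z)
         * (binomz ((ncols mu lam)%:Z - 1)
                   ((nboxes mu lam)%:Z - k%:Z))%:~R)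
        *: G alpha beta mu)
      (G alpha beta (one_column k) * G alpha beta lam))
  /\
  (* Type 2 *)
  (forall k : nat,
    sums_to (fun nu => included lam nu && (ncols nu lam == k))
      (fun nu =>
        ((alpha + beta) ^ ((nboxes nu lam)%:Z - k%:Z))
        *: G (- alpha) (- beta) nu)
      (hsymf k (fun i => fvar i / (1 + alpha *: fvar i))
       * G (- alpha) (- beta) lam)
    /\
    sums_to (fun nu => included lam nu && vertical_strip nu lam)
      (fun nu =>
        ((alpha + beta) ^ ((nboxes nu lam)%:Z - k%:Z)
         * (binomz ((nboxes nu lam)%:Z - (ncols nu lam)%:Z)
                   (k%:Z - (ncols nu lam)%:Z))%:~R)
        *: G (- alpha) (- beta) nu)
      (esymf k (fun i => fvar i / (1 + alpha *: fvar i))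
       * G (- alpha) (- beta) lam))
  /\
  (* Type 3 *)
  (forall k : nat,
    sums_to predT
      (fun mu => vcoef alpha beta k mu lam *: G (- alpha) (- beta) mu)
      (hsymf k fvar * G (- alpha) (- beta) lam)
    /\
    sums_to predT
      (fun mu => vbarcoef alpha beta k mu lam *: G (- alpha) (- beta) mu)
      (esymf k fvar * G (- alpha) (- beta) lam)).
Proof.
split; first by move=> k k1; split; [apply: G_row_pieri|apply: G_column_pieri].
split=> k; split; [exact: hsymf_yvar_pieri|exact: esymf_yvar_pieri|exact: hsymf_pieri|exact: esymf_pieri].
Qed.
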